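(* For any integers $d\ge 0$, $0\le m\le d$, $c_1,\ldots,c_d\in\mathbb{N}\setminus\{2\}$ such that $c_1\ge 3$ if $m\ge 1$, and any complex numbers $z_0,\ldots,z_d$ with $|z_j|<1$, $j=0,1,\ldots,d$, we have $$\sum_{\substack{a_0,a_1,\ldots,a_d\ge 0\\ a_m\ge 1}}\zeta^{\star}(\{2\}^{a_0},c_1,\{2\}^{a_1},\ldots,c_d,\{2\}^{a_d},1)\,z_0^{2a_0}z_1^{2a_1}\cdots z_d^{2a_d}=z_m^2\sum_{k_0\ge k_1\ge\cdots\ge k_d\ge 1}\frac{1}{k_m^2}\,\prod_{i=0}^d\frac{(-1)^{k_i\delta_i}k_i^{\delta_i-1}}{k_i^2-z_i^2}\,S^{\sharp}_{k_{i-1},k_i}(\{1\}^{c_i-3}),$$ where $c_0=c_{d+1}=1$, $k_{-1}=0$, $\delta_i=\delta(c_i)+\delta(c_{i+1})$ for $0\le i\le d$, and $\delta(c)=2$ if $c=0$, $\delta(c)=1$ if $c=1$, $\delta(c)=0$ if $c\ge 3$.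
   Context: $\mathbb{N}$ is the set of positive integers. For positive integers $s_1,\ldots,s_m$ with $s_1\ge 2$, $\zeta^\star(s_1,\ldots,s_m)=\sum_{k_1\ge\cdots\ge k_m\ge 1}\frac{1}{k_1^{s_1}\cdots k_m^{s_m}}$ (sum over positive integers), and $\zeta^\star(\emptyset)=1$. $\{s\}^a$ denotes the sequence consisting of $a$ copies of $s$. When $d=0$ the argument string is $(\{2\}^{a_0},1)$. $\Delta(a,b)=0$ if $a=b$ and $\Delta(a,b)=1$ otherwise. For a string $\mathbf r=(r_1,\ldots,r_c)$ of positive integers and integers $k\ge 0$, $m\ge 1$, the multiple sharp sum is $$S^{\sharp}_{k,m}(r_1,\ldots,r_c)=\sum_{k\ge l_1\ge\cdots\ge l_c\ge m}\frac{2^{\Delta(k,l_1)+\Delta(l_1,l_2)+\cdots+\Delta(l_{c-1},l_c)+\Delta(l_c,m)}}{l_1^{r_1}\cdots l_c^{r_c}}\quad\text{if }\mathbf r\ne\emptyset\text{ and }k\ge m,$$ and $S^{\sharp}_{k,m}(\mathbf r)=2^{\Delta(k,m)}$ if $\mathbf r=\emptyset$ or $k<m$. The string $\{1\}^{c_i-3}$ is empty when $c_i\in\{1,3\}$, so that then $S^{\sharp}_{k_{i-1},k_i}(\{1\}^{c_i-3})=2^{\Delta(k_{i-1},k_i)}$. In all sums the indices are integers, and $0^0=1$ in power series. *)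

(* Defs.v *)
From HB Require Import structures.
From mathcomp Require Import all_boot all_order all_algebra.
From mathcomp Require Import finmap complex.
From mathcomp Require Import all_classical all_reals all_analysis.
From mathcomp.analysis.showcase Require summability.

Set Implicit Arguments.
Unset Strict Implicit.
Unset Printing Implicit Defensive.

Import Order.TTheory GRing.Theory Num.Theory.
Import numFieldNormedType.Exports.

Local Open Scope classical_set_scope.
Local Open Scope ring_scope.

(* Unconditional summability: the net of the partial sums over the finite sets
   of indices, ordered by inclusion, converges to l. For real or complex terms
   this is absolute summability with sum l. *)
Definition has_sum (K : numFieldType) (I : choiceType) (P : pred I)
    (f : I -> K) (l : K) : Prop :=
  (fun J : {fset I} => \sum_(i <- J | P i) f i : K^o)
    @ @summability.totally I --> (l : K^o).

(* k_1 >= ... >= k_n >= 1 *)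
Definition decr_pos (k : seq nat) : bool :=
  sorted geq k && all (leq 1) k.

(* The terms are nonnegative, so the series is the supremum of its finite
   partial sums; [fine] returns 0 for a divergent series, which does not occur
   when s is empty or starts with an integer >= 2. *)
Definition zeta_star (R : realType) (s : seq nat) : R :=
  fine (\esum_(k in [set k : seq nat | (size k == size s) && decr_pos k])
          (\prod_(p <- zip k s) (p.1%:R ^- p.2))%:E).

Definition Delta (a b : nat) : nat := if a == b then 0%N else 1%N.

(* The sum runs over l = (l_1, ..., l_c) with k >= l_1 >= ... >= l_c >= m, and
   the exponent is Delta(k, l_1) + Delta(l_1, l_2) + ... + Delta(l_c, m). *)
Definition sharp (R : realType) (k m : nat) (r : seq nat) : R :=
  if (r == [::]) || (k < m)%N then 2 ^+ Delta k m
  else \sum_(l : (size r).-tuple 'I_k.+1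
              | path geq k (rcons (map val l) m))
         2 ^+ sumn (pairmap Delta k (rcons (map val l) m))
           / \prod_(p <- zip (map val l) r) p.1%:R ^+ p.2.

(* The value at c = 2 is irrelevant. *)
Definition delta (c : nat) : nat :=
  match c with 0 => 2 | 1 => 1 | _ => 0 end.

(* For c = (c_1, ..., c_d), [c_ext c i] is c_i, with c_0 = c_{d+1} = 1. *)
Definition c_ext (c : seq nat) (i : nat) : nat := nth 1%N (1%N :: c) i.

(* ({2}^{a_0}, c_1, {2}^{a_1}, ..., c_d, {2}^{a_d}, 1) *)
Definition zeta_arg (d : nat) (c : d.-tuple nat) (a : d.+1.-tuple nat) :
    seq nat :=
  nseq (thead a) 2
    ++ flatten [seq p.1 :: nseq p.2 2 | p <- zip c (behead a)]
    ++ [:: 1%N].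

Definition gf_term (R : realType) (d : nat) (c : d.-tuple nat)
    (z : 'I_d.+1 -> R[i]) (a : d.+1.-tuple nat) : R[i] :=
  (zeta_star R (zeta_arg c a))%:C%C * \prod_(j < d.+1) z j ^+ (2 * tnth a j).

(* [nth 0 (0 :: k) i] is k_{i-1}, with k_{-1} = 0. The exponent of k_i may be
   -1, hence the integer power. The truncated subtraction c_i - 3 makes the
   string {1}^{c_i - 3} empty when c_i = 1. *)
Definition sharp_term (R : realType) (d : nat) (m : 'I_d.+1) (c : d.-tuple nat)
    (z : 'I_d.+1 -> R[i]) (k : d.+1.-tuple nat) : R[i] :=
  (tnth k m)%:R ^- 2 *
  \prod_(i < d.+1)
    (let del := (delta (c_ext c i) + delta (c_ext c i.+1))%N in
     let ki := tnth k i in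
     (-1) ^+ (ki * del) * ki%:R ^ (del%:Z - 1) / (ki%:R ^+ 2 - z i ^+ 2)
       * (sharp R (nth 0%N (0%N :: k) i) ki (nseq (c_ext c i - 3) 1%N))%:C%C).

(* Main.v *)
Require Import Defs.
From HB Require Import structures.
From mathcomp Require Import all_boot all_order all_algebra.
From mathcomp Require Import finmap complex.
From mathcomp Require Import all_classical all_reals all_analysis.
From mathcomp Require Import ring lra zify.

(** The idea is to prove the identity first for truncated sums, with binomial
    weights, and then to remove the truncation.

    Let H_N(s) be the zeta-star sum restricted to k_1 <= N, and let
    b_N(k) = 'C(N, k) / 'C(N + k, k). The truncated value of the string
    ({2}^{a_0}, c_1, {2}^{a_1}, ..., c_d, {2}^{a_d}, 1) equals the finite sum
      sum over N >= k_0 >= ... >= k_d >= 1 of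
        b_N(k_0) Q(k_0, ..., k_d) k_0^-(3 + 2 a_0) ... k_d^-(3 + 2 a_d),
    where the kernel Q collects the signs, the powers k_i^{delta_i} and the
    sharp sums ([tzeta_zargs]). This is an induction on c, a_0 and N. If a_0 > 0,
    both sides have the same increment in N, because
    b_N(k) (1 - k^2 / N^2) = b_{N-1}(k). If a_0 = 0, the increment of the left
    side is N^{-c_1} times the truncated value of a shorter string, and the sum
    over k_0 on the right side produces the same power of N: for exponents 1 and
    3 by telescoping, for larger exponents by repeating the telescoping along the
    string of ones of the sharp sum ([sum_binratio_kernel]).

    Multiplying by the powers of z and summing over a with a_m >= 1 gives, for
    each chain k, a product of geometric series with ratios z_j^2 / k_j^2. Their
    sums are z_m^2 / k_m^2 times the product of the k_j^2 / (k_j^2 - z_j^2), so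
    for every N the truncated generating function is z_m^2 times the sum of
    b_N(k_0) times the summands of the right side ([has_sum_gf_trunc]).

    Finally N tends to infinity on both sides by dominated convergence. All terms
    are controlled by |Q(k)| k_m^-2 times the product of the k_i^-3, whose sums over
    chains are bounded ([chain_sum_bound]): summing k_0^-2 against a sharp sum of
    ones from k_1 on gives at most a constant times 1 / k_1, so that the weight k^-2
    passes from each index to the next. The condition c_1 >= 3 for m >= 1 is what
    provides this weight at k_0. The same bound applied to the finite identity
    bounds the truncated values uniformly, so that they converge to the zeta-star
    values and the generating function converges absolutely for |z_j| < 1. *)

Set Implicit Arguments.
Unset Strict Implicit.
Unset Printing Implicit Defensive.

Import Order.TTheory GRing.Theory Num.Theory.
Import numFieldNormedType.Exports.

Local Open Scope classical_set_scope.
Local Open Scope ring_scope.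

#[local] Existing Instance summability.totally_filter.

(** * Unconditional sums *)

Lemma sum_fsetD (V : nmodType) (I : choiceType) (f : I -> V) (A B : {fset I}) :
  (A `<=` B)%fset ->
  \sum_(i <- B) f i = \sum_(i <- A) f i + \sum_(i <- (B `\` A)%fset) f i.
Proof.
move=> AB; rewrite (big_fsetID _ (mem A))/=; congr (_ + _); apply: eq_fbigl => i.
  by rewrite !inE /= -(@in_fsetI _ B A) (fsetIidPr _).
by rewrite !inE/= andbC.
Qed.

Section Unconditional.
Context {K : numFieldType} {I : choiceType}.
Implicit Types (P : pred I) (f g : I -> K) (l s x : K).

Lemma has_sumP P f l :
  has_sum P f l <->
  (forall e : K, 0 < e -> exists J0 : {fset I},
     forall J : {fset I}, (J0 `<=` J)%fset -> `|\sum_(i <- J | P i) f i - l| <= e).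
Proof.
split=> [fl e e0|fl].
  move/cvgrPdist_le: fl => fl; have [J0 _ J0P] := fl e e0.
  by exists J0 => J J0J; rewrite distrC; exact: J0P.
apply/cvgrPdist_le => e e0; have [J0 J0P] := fl e e0.
by exists J0 => // J /= J0J; rewrite distrC; exact: J0P.
Qed.

Lemma has_sum_mkcond P f l :
  has_sum P f l <-> has_sum predT (fun i => if P i then f i else 0) l.
Proof.
rewrite /has_sum.
suff -> : (fun J : {fset I} => \sum_(i <- J | P i) f i : K^o) =
  (fun J : {fset I} => \sum_(i <- J) (if P i then f i else 0) : K^o) by [].
by apply/funext => J; rewrite big_mkcond.
Qed.

Lemma has_sumZ x f l :
  has_sum predT f l -> has_sum predT (fun i => x * f i) (x * l).
Proof.
move=> fl; rewrite /has_sum.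
under eq_fun do rewrite -mulr_sumr.
exact: cvgMl_tmp.
Qed.

Lemma has_sum0 : has_sum predT (fun _ : I => 0 : K) 0.
Proof.
by apply/has_sumP => e e0; exists fset0 => J _; rewrite big1// subr0 normr0 ltW.
Qed.

Lemma has_sumD f g l s : has_sum predT f l -> has_sum predT g s ->
  has_sum predT (fun i => f i + g i) (l + s).
Proof.
move=> fl gs; rewrite /has_sum.
under eq_fun do rewrite big_split/=.
exact: cvgD.
Qed.

Lemma has_sum_sum (T : Type) (r : seq T) (F : T -> I -> K) (l : T -> K) :
  (forall t, has_sum predT (F t) (l t)) ->
  has_sum predT (fun i => \sum_(t <- r) F t i) (\sum_(t <- r) l t).
Proof.
move=> Fl; elim: r => [|t r IH].
  by rewrite big_nil; under eq_fun do rewrite big_nil; exact: has_sum0.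
rewrite big_cons; under eq_fun do rewrite big_cons.
exact: has_sumD.
Qed.

Lemma has_sum_finsupp (J : {fset I}) f :
  (forall i, i \notin J -> f i = 0) -> has_sum predT f (\sum_(i <- J) f i).
Proof.
move=> f0; apply/has_sumP => e e0; exists J => J' JJ'.
rewrite -(big_fset_incl _ JJ' (fun i _ iJ => f0 i iJ)) subrr normr0.
exact: ltW.
Qed.

(** Tannery's theorem for unconditional sums. Outside a finite set J that almost
    exhausts the dominating family g, all the families fN N contribute little,
    uniformly in N, and on J the convergence is that of a finite sum. *)
Lemma tannery (fN : nat -> I -> K) f g (sN : nat -> K) s G :
  (forall N i, `|fN N i| <= g i) -> has_sum predT g G ->
  (forall i, (fun N => fN N i : K^o) @ \oo --> (f i : K^o)) ->
  (forall N, has_sum predT (fN N) (sN N)) -> has_sum predT f s ->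
  (sN : nat -> K^o) @ \oo --> (s : K^o).
Proof.
move=> fg gG fNf fNsN fs; apply/cvgrPdist_le => e e0.
(* five errors: f on J against s, f against fN on J, fN outside J (two of them,
   through the sums of g over J and over a larger set), and fN against sN *)
pose e5 := e / 5%:R; have e50 : 0 < e5 by rewrite divr_gt0.
have [J1 J1P] := iffLR (has_sumP _ _ _) gG e5 e50.
have [J2 J2P] := iffLR (has_sumP _ _ _) fs e5 e50.
pose J := (J1 `|` J2)%fset.
have sJ : (fun N => \sum_(i <- J) fN N i : K^o) @ \oo -->
    (\sum_(i <- J) f i : K^o).
  by apply: cvg_big => [|i _]; [exact: add_continuous|exact: fNf].
move/cvgrPdist_le: sJ => sJ; have := sJ e5 e50.
apply: filterS => N HN.
have [J3 J3P] := iffLR (has_sumP _ _ _) (fNsN N) e5 e50.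
pose J' := (J `|` J3)%fset.
have JJ' : (J `<=` J')%fset by exact: fsubsetUl.
have h1 := J2P _ (fsubsetUr J1 J2); rewrite -/J in h1.
have h2 := J3P _ (fsubsetUr J J3); rewrite -/J' in h2.
have h3 := J1P _ (fsubsetUl J1 J2); rewrite -/J in h3.
have h4 := J1P _ (fsubset_trans (fsubsetUl J1 J2) JJ').
have split_ (h : I -> K) :
    \sum_(i <- J') h i - \sum_(i <- J) h i = \sum_(i <- (J' `\` J)%fset) h i.
  by rewrite (sum_fsetD _ JJ') addrC addKr.
have h5 : `|\sum_(i <- J') fN N i - \sum_(i <- J) fN N i| <= e5 + e5.
  rewrite split_; apply: (le_trans (ler_norm_sum _ _ _)).
  apply: (@le_trans _ _ (\sum_(i <- (J' `\` J)%fset) g i)).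
    by apply: ler_sum => i _; exact: fg.
  rewrite -split_.
  have sr : \sum_(i <- J') g i - \sum_(i <- J) g i \is Num.real.
    apply: ger0_real; rewrite split_ sumr_ge0// => i _.
    exact: le_trans (normr_ge0 _) (fg 0%N i).
  apply: (le_trans (real_ler_norm sr)).
  rewrite (_ : _ - _ = (\sum_(i <- J') g i - G) - (\sum_(i <- J) g i - G)).
    by apply: (le_trans (ler_normB _ _)); exact: lerD.
  by rewrite opprB addrA subrK.
have -> : s - sN N = - (\sum_(i <- J) f i - s)
    + ((\sum_(i <- J) f i - \sum_(i <- J) fN N i)
    + (- (\sum_(i <- J') fN N i - \sum_(i <- J) fN N i)
    + (\sum_(i <- J') fN N i - sN N))) by ring.
have -> : e = e5 + (e5 + ((e5 + e5) + e5)) by rewrite /e5; field.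
do 3 (apply: (le_trans (ler_normD _ _)); apply: lerD; rewrite ?normrN//).
Qed.

Lemma cvg_seq_unique (u : nat -> K) l s :
  (u : nat -> K^o) @ \oo --> (l : K^o) ->
  (u : nat -> K^o) @ \oo --> (s : K^o) -> l = s.
Proof. exact: (cvg_unique (@norm_hausdorff _ K^o)). Qed.

Lemma lim_scale (u v : nat -> K) x l s : (forall N, v N = x * u N) ->
  (u : nat -> K^o) @ \oo --> (l : K^o) ->
  (v : nat -> K^o) @ \oo --> (s : K^o) -> s = x * l.
Proof.
move=> vu ul vs; apply: (cvg_seq_unique vs).
by rewrite (funext vu); exact: cvgMl_tmp.
Qed.

End Unconditional.

Arguments has_sumZ {K I} x {f l}.

Lemma nonneg_summable (R : realType) (I : choiceType) (f : I -> R) (B : R) :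
  (forall i, 0 <= f i) -> (forall J : {fset I}, \sum_(i <- J) f i <= B) ->
  exists l, has_sum predT f l.
Proof.
move=> f0 fB; pose A := [set (\sum_(i <- J) f i) | J in [set: {fset I}]]%classic.
have supA : has_sup A.
  split; first by exists (\sum_(i <- fset0) f i), fset0.
  by exists B => _ [J _ <-].
exists (sup A); apply/has_sumP => e e0.
have [_ [J0 _ <-] J0e] := sup_adherent e0 supA.
exists J0 => J J0J.
have le1 : \sum_(i <- J) f i <= sup A by apply: (sup_upper_bound supA); exists J.
have le2 : \sum_(i <- J0) f i <= \sum_(i <- J) f i.
  by rewrite (sum_fsetD f J0J) lerDl sumr_ge0.
rewrite ler_norml; apply/andP; split; first by lra.
lra.
Qed.

Lemma real_summable (R : realType) (I : choiceType) (f g : I -> R) (B : R) :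
  (forall i, `|f i| <= g i) -> (forall J : {fset I}, \sum_(i <- J) g i <= B) ->
  exists l, has_sum predT f l.
Proof.
move=> fg gB.
have g0 i : 0 <= g i by exact: le_trans (fg i).
have [G HG] := nonneg_summable g0 gB.
have [i|J|S HS] := @nonneg_summable _ _ (fun i => f i + g i) (B + B).
- by have := fg i; rewrite ler_norml => /andP[]; lra.
- rewrite big_split/=; apply: lerD => //; apply: le_trans (gB J).
  by apply: ler_sum => i _; exact: le_trans (ler_norm _) (fg i).
exists (S + (-1) * G); have := has_sumD HS (has_sumZ (-1) HG).
by under eq_fun do rewrite mulN1r addrK.
Qed.

Lemma normc_real (R : rcfType) (x : R) : `|x%:C%C| = `|x|%:C%C.
Proof. by rewrite normc_def/= expr0n/= addr0 sqrtr_sqr. Qed.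

Lemma has_sum_real_complex (R : realType) (I : choiceType) (f : I -> R) (l : R) :
  has_sum predT f l -> has_sum predT (fun i => (f i)%:C%C) l%:C%C.
Proof.
move=> /has_sumP fl; apply/has_sumP => e; rewrite ltcE/= => /andP[/eqP ie re].
have [J0 J0P] := fl _ re; exists J0 => J /J0P.
rewrite -rmorph_sum -rmorphB/= normc_real -lecR => /le_trans; apply.
by rewrite lecE/= ie eqxx lexx.
Qed.

(** Completeness enters here: a dominated complex family is summed through its
    real and imaginary parts, and a dominated real family f through the two
    nonnegative families f + g and g, whose sums are suprema. *)
Lemma complex_summable (R : realType) (I : choiceType) (f : I -> R[i])
    (g : I -> R) (B : R) :
  (forall i, `|f i| <= (g i)%:C%C) ->
  (forall J : {fset I}, \sum_(i <- J) g i <= B) ->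
  exists l, has_sum predT f l.
Proof.
move=> fg gB.
have [|l1 H1] := @real_summable _ _ (fun i => complex.Re (f i)) g B _ gB.
  by move=> i; have := le_trans (normc_ge_Re (f i)) (fg i); rewrite lecR.
have [|l2 H2] := @real_summable _ _ (fun i => complex.Im (f i)) g B _ gB.
  move=> i; have ifg : `|f i * 'i%C| <= (g i)%:C%C.
    rewrite normrM [X in _ * X](_ : _ = 1) ?mulr1//.
    by rewrite normc_def/= expr0n expr1n add0r sqrtr1.
  have := le_trans (normc_ge_Re _) ifg.
  by rewrite ReiNIm normrN lecR.
exists (l1%:C%C + 'i%C * l2%:C%C).
have := has_sumD (has_sum_real_complex H1) (has_sumZ 'i%C (has_sum_real_complex H2)).
by under eq_fun do rewrite -complexE.
Qed.

(** * Truncated zeta-star values *)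

(** The recursion on the outermost index makes sums over chains iterated sums. *)
Fixpoint chains (n N : nat) : seq (seq nat) :=
  if n is n'.+1 then [seq k :: l | k <- iota 1 N, l <- chains n' k]
  else [:: [::]].

Lemma mem_chains n N k :
  (k \in chains n N) = [&& size k == n, path geq N k & all (leq 1) k].
Proof.
elim: n N k => [|n IH] N k /=.
  by rewrite inE; case: k.
apply/allpairsPdep/idP => [[x [l [xN]]]|].
  rewrite IH => /and3P[/eqP sl xl l1] -> /=; rewrite mem_iota in xN.
  by rewrite sl eqxx xl l1 !andbT/=; lia.
case: k => [|x l] //= /and3P[]; rewrite eqSS => /eqP sl /andP[xN xl] /andP[x1 l1].
by exists x, l; split => //; rewrite ?IH ?sl ?eqxx ?xl ?mem_iota//; lia.
Qed.

Lemma chains_uniq n N : uniq (chains n N).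
Proof.
elim: n N => [|n IH] N //=; apply: allpairs_uniq_dep => //; first exact: iota_uniq.
by move=> -[x k] -[y l] _ _ /= [-> ->].
Qed.

Lemma sum_chainsS (V : nmodType) n N (F : seq nat -> V) :
  \sum_(k <- chains n.+1 N) F k =
  \sum_(1 <= k < N.+1) \sum_(l <- chains n k) F (k :: l).
Proof. by rewrite /= big_allpairs_dep /index_iota subSS subn0. Qed.

Section TruncatedZetaStar.
Variable R : realType.
Implicit Types s k : seq nat.

Definition zterm s k : R := \prod_(p <- zip k s) (p.1%:R ^- p.2).

Definition tzeta s N : R := \sum_(k <- chains (size s) N) zterm s k.

Lemma zterm_ge0 s k : 0 <= zterm s k.
Proof. by apply: prodr_ge0 => p _; rewrite invr_ge0 exprn_ge0. Qed.

Lemma tzeta_nil N : tzeta [::] N = 1.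
Proof. by rewrite /tzeta big_seq1 /zterm big_nil. Qed.

Lemma tzeta_cons x s N :
  tzeta (x :: s) N = \sum_(1 <= k < N.+1) k%:R ^- x * tzeta s k.
Proof.
rewrite /tzeta sum_chainsS; apply: eq_bigr => k _; rewrite mulr_sumr.
by apply: eq_bigr => l _; rewrite /zterm/= big_cons.
Qed.

Lemma tzeta_cons0 x s : tzeta (x :: s) 0 = 0.
Proof. by rewrite tzeta_cons big_nat_cond big1//; move=> i; lia. Qed.

Lemma tzeta_consS x s N :
  tzeta (x :: s) N.+1 = tzeta (x :: s) N + N.+1%:R ^- x * tzeta s N.+1.
Proof. by rewrite !tzeta_cons big_nat_recr. Qed.

Lemma tzeta_ge0 s N : 0 <= tzeta s N.
Proof. by apply: sumr_ge0 => k _; exact: zterm_ge0. Qed.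

Lemma tzeta_nondecreasing s : nondecreasing_seq (tzeta s).
Proof.
apply/nondecreasing_seqP => N; case: s => [|x s]; first by rewrite !tzeta_nil.
by rewrite tzeta_consS lerDl mulr_ge0 ?tzeta_ge0// invr_ge0 exprn_ge0.
Qed.

(** A bound on the truncations excludes the divergent case, in which [fine]
    would return 0 instead of the supremum. *)
Lemma cvg_zeta_star s (B : R) : (forall N, tzeta s N <= B) ->
  tzeta s @ \oo --> zeta_star R s.
Proof.
move=> tB; have ub : has_ubound (range (tzeta s)) by exists B => _ [N _ <-].
suff -> : zeta_star R s = sup (range (tzeta s)).
  by apply: nondecreasing_cvgn => //; exact: tzeta_nondecreasing.
have tsup N : tzeta s N <= sup (range (tzeta s)) by apply: ub_le_sup => //; exists N.
have tzE N : (tzeta s N)%:E = (\sum_(k \in [set` chains (size s) N]) (zterm s k)%:E)%E.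
  by rewrite -fsbig_seq ?chains_uniq// sumEFin.
rewrite /zeta_star -[RHS]/(fine (sup (range (tzeta s)))%:E); congr fine.
apply/eqP; rewrite eq_le; apply/andP; split.
  apply: ge_ereal_sup => _ [X [finX Xs] <-].
  set r := fset_set X; pose N := (\max_(k <- r) head 0 k)%N.
  rewrite fsbig_finite//= -/r sumEFin lee_fin.
  apply: le_trans (tsup N); rewrite /tzeta.
  have rN : {subset r <= chains (size s) N}.
    move=> k kr; have kX : X k by move: kr; rewrite in_fset_set// inE.
    have /= /andP[/eqP sk /andP[sok all1]] := Xs _ kX.
    rewrite mem_chains sk eqxx all1 andbT/=.
    have : (head 0 k <= N)%N by apply: (leq_bigmax_seq (F := head 0%N)).
    by case: (k) sok => //= y l -> ->.
  rewrite -[X in _ <= X](_ : \sum_(k <- [fset k in chains (size s) N]%fset) zterm s k = _).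
    have rN' : (r `<=` [fset k in chains (size s) N])%fset.
      by apply/fsubsetP => k /rN; rewrite inE.
    by rewrite (sum_fsetD _ rN') lerDl sumr_ge0// => k _; exact: zterm_ge0.
  by rewrite big_imfset//= undup_id ?chains_uniq.
rewrite -ereal_sup_EFin//; last by exists (tzeta s 0), 0%N.
apply: ge_ereal_sup => _ [_ [N _ <-] <-].
apply: esum_ge; exists [set` chains (size s) N]; last by rewrite tzE.
split=> [|k /=]; first exact: finite_seq.
by rewrite mem_chains /decr_pos => /and3P[-> /path_sorted -> ->].
Qed.

End TruncatedZetaStar.

(** * Sharp sums *)

Section SharpSums.
Variable R : realType.

Definition sharp_term_seq (k m : nat) (r l : seq nat) : R :=
  2 ^+ sumn (pairmap Delta k (rcons l m)) / \prod_(p <- zip l r) p.1%:R ^+ p.2.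

(** [sharp] with the index type ['I_K] made independent of k, so that the
    recursion on the string does not change the type of the indices. *)
Definition sharp_upto (K k m : nat) (r : seq nat) : R :=
  \sum_(l : (size r).-tuple 'I_K | path geq k (rcons (map val l) m))
    sharp_term_seq k m r (map val l).

Lemma path_rcons_geq (k m : nat) (l : seq nat) :
  path geq k (rcons l m) -> (m <= k)%N.
Proof.
elim: l k => [|x l IH] k /=; first by rewrite andbT.
by move=> /andP[/= xk /IH mx]; exact: leq_trans xk.
Qed.

(** Splits off the outermost index of the sum. Both sides keep the index type
    ['I_K], which is the purpose of the parameter K. *)
Lemma sharp_upto_cons K k m x r : (k < K)%N ->
  sharp_upto K k m (x :: r) = \sum_(m <= l < k.+1)
    2 ^+ Delta k l / l%:R ^+ x * sharp_upto K l m r.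
Proof.
move=> kK; rewrite /sharp_upto.
pose h (p : 'I_K * (size r).-tuple 'I_K) : (size (x :: r)).-tuple 'I_K :=
  [tuple of p.1 :: p.2].
have hbij : bijective h.
  exists (fun t => (thead t, [tuple of behead t])) => [[a t]|t].
    by congr pair; apply: val_inj.
  by rewrite /h/= [t in RHS]tuple_eta.
rewrite (reindex h)/=; last exact: onW_bij.
rewrite -(pair_big_dep (fun i : 'I_K => (i <= k)%N)
  (fun (i : 'I_K) (t : (size r).-tuple 'I_K) => path geq i (rcons (map val t) m))
  (fun i t => sharp_term_seq k m (x :: r) (map val (h (i, t)))))/=.
transitivity (\sum_(i < K | (i <= k)%N) 2 ^+ Delta k i / i%:R ^+ x *
    sharp_upto K i m r).
  apply: eq_bigr => i _; rewrite /sharp_upto mulr_sumr; apply: eq_bigr => t _.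
  rewrite /sharp_term_seq/= big_cons/= exprD invfM -!mulrA; congr (_ * _).
  by rewrite mulrCA.
rewrite -(big_mkord (fun i => i <= k)%N (fun i => 2 ^+ Delta k i / i%:R ^+ x *
    sharp_upto K i m r)).
have [mk|km] := leqP m k; last first.
  rewrite big1 ?big_geq// => i ik; rewrite /sharp_upto big1 ?mulr0// => t.
  by move=> /path_rcons_geq; lia.
rewrite (big_cat_nat (n := m))//=; last lia.
rewrite [X in X + _]big_nat_cond [X in X + _]big1 ?add0r; last first.
  move=> i /andP[/andP[_ im] _]; rewrite /sharp_upto big1 ?mulr0// => t.
  by move=> /path_rcons_geq; lia.
rewrite (big_cat_nat (n := k.+1))//=; last lia.
rewrite [X in _ + X]big_nat_cond [X in _ + X]big1 ?addr0; last by move=> i; lia.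
by rewrite big_nat_cond [RHS]big_nat_cond; apply: eq_bigl => i; lia.
Qed.

Lemma sharp_upto_nil K k m :
  sharp_upto K k m [::] = if (m <= k)%N then 2 ^+ Delta k m else 0.
Proof.
rewrite /sharp_upto big_mkcond (big_pred1 [tuple]) => [|t]; last exact/esym/eqP/tuple0.
by rewrite /= andbT /sharp_term_seq/= big_nil divr1 addn0.
Qed.

Lemma sharp_upto_indep K K' k m r : (k < K)%N -> (k < K')%N ->
  sharp_upto K k m r = sharp_upto K' k m r.
Proof.
elim: r k => [|x r IH] k kK kK'.
  by rewrite !sharp_upto_nil.
rewrite !sharp_upto_cons//; apply: eq_big_nat => l lk.
by rewrite IH//; lia.
Qed.

Lemma sharp_nil k m : sharp R k m [::] = 2 ^+ Delta k m.
Proof. by []. Qed.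

Lemma sharpE k m r : (m <= k)%N -> sharp R k m r = sharp_upto k.+1 k m r.
Proof.
move=> mk; rewrite /sharp ltnNge mk orbF; case: eqP => // ->.
by rewrite sharp_upto_nil mk.
Qed.

(** The recursion through which every identity and bound on sharp sums is
    proved. *)
Lemma sharp_cons k m x r : (m <= k)%N ->
  sharp R k m (x :: r) = \sum_(m <= l < k.+1)
    2 ^+ Delta k l / l%:R ^+ x * sharp R l m r.
Proof.
move=> mk; rewrite sharpE// sharp_upto_cons//; apply: eq_big_nat => l lk.
by rewrite [in RHS]sharpE; [congr (_ * _); apply: sharp_upto_indep|]; lia.
Qed.

Lemma sharp_ge0 k m r : 0 <= sharp R k m r.
Proof.
rewrite /sharp; case: ifP => _; first exact: exprn_ge0.
apply: sumr_ge0 => l _; rewrite divr_ge0 ?exprn_ge0//.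
by apply: prodr_ge0 => p _; rewrite exprn_ge0.
Qed.

End SharpSums.

(** * Ratios of binomial coefficients *)

Lemma exchange_big_triangle (V : nmodType) (m n : nat) (F : nat -> nat -> V) :
  \sum_(m <= k < n) \sum_(m <= l < k.+1) F k l =
  \sum_(m <= l < n) \sum_(l <= k < n) F k l.
Proof.
elim: n => [|n IH]; first by rewrite !big_geq.
have [mn|nm] := leqP m n; last by rewrite !big_geq.
rewrite big_nat_recr//= IH [RHS]big_nat_recr//= big_nat1.
rewrite [X in _ + X]big_nat_recr//= addrA; congr (_ + _).
rewrite -big_split/=; apply: eq_big_nat => l /andP[_ ln].
by rewrite [RHS]big_nat_recr//= ltnW.
Qed.

Lemma telescope_tail (V : zmodType) (N m : nat) (x y : nat -> V) :
  (m <= N.+1)%N -> y N.+1 = 0 ->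
  (forall k, (m <= k <= N)%N -> x k + y k.+1 = y k) ->
  \sum_(m <= k < N.+1) x k = y m.
Proof.
move=> mN y0 xy; have -> : y m = y m - y N.+1 by rewrite y0 subr0.
rewrite -opprB -telescope_sumr// -sumrN; apply: eq_big_nat => k kN.
by rewrite opprB -(xy k) ?addrK//; lia.
Qed.

Section BinomialRatio.
Variable R : realType.
Implicit Types N k m : nat.

(** This is 'C(N, k) / 'C(N + k, k) = N!^2 / ((N - k)! (N + k)!); the product
    vanishes for k > N because of its factor j = N. *)
Definition binratio N k : R := \prod_(j < k) ((N%:R - j%:R) / (N + j.+1)%:R).

Lemma binratio0 N : binratio N 0 = 1. Proof. by rewrite /binratio big_ord0. Qed.

Lemma binratioS N k :
  (N + k.+1)%:R * binratio N k.+1 = (N%:R - k%:R) * binratio N k.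
Proof.
rewrite /binratio big_ord_recr/=.
have : (N + k.+1)%:R != 0 :> R by rewrite pnatr_eq0; lia.
by move: (\prod_(j < k) _) => P h; field.
Qed.

Lemma binratio_small N k : (N < k)%N -> binratio N k = 0.
Proof.
move=> Nk; rewrite /binratio; apply/eqP/prodf_eq0; exists (Ordinal Nk) => //=.
by rewrite subrr mul0r.
Qed.

Lemma binratio_ge0 N k : 0 <= binratio N k.
Proof.
have [kN|/binratio_small-> //] := leqP k N.
apply: prodr_ge0 => j _; rewrite divr_ge0// subr_ge0 ler_nat.
by have := ltn_ord j; lia.
Qed.

Lemma binratio_le1 N k : binratio N k <= 1.
Proof.
have [kN|/binratio_small-> //] := leqP k N.
apply: prodr_ile1 => j _; have jN : (j <= N)%N by have := ltn_ord j; lia.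
rewrite divr_ge0 ?subr_ge0 ?ler_nat//= ler_pdivrMr ?ltr0n; last lia.
by rewrite mul1r lerBlDr -natrD ler_nat; lia.
Qed.

(** Passing from N to N + 1 divides the k-th weight by 1 - k^2 / (N + 1)^2, which is
    how the truncated sums acquire factors k^-2. *)
Lemma binratio_pred N k :
  binratio N.+1 k * (N.+1%:R ^+ 2 - k%:R ^+ 2) = N.+1%:R ^+ 2 * binratio N k.
Proof.
elim: k => [|k IH]; first by rewrite !binratio0; ring.
have N0 : (N + k.+1)%:R != 0 :> R by rewrite pnatr_eq0; lia.
have e1 := binratioS N k; have e2 := binratioS N.+1 k.
apply: (mulfI N0); rewrite [RHS]mulrCA e1 [RHS]mulrCA -IH.
transitivity ((N%:R - k%:R) * (N + k.+1)%:R *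
    ((N.+1 + k.+1)%:R * binratio N.+1 k.+1)); last by rewrite e2; ring.
by ring.
Qed.

Lemma binratio_lb N k : 1 - k%:R ^+ 2 / N.+1%:R <= binratio N.+1 k.
Proof.
elim: k => [|k IH]; first by rewrite binratio0 expr0n/= mul0r subr0.
have a0 : 0 < N.+1%:R :> R by [].
have d0 : 0 < (N.+1 + k.+1)%:R :> R by [].
have e := binratioS N.+1 k.
have -> : binratio N.+1 k.+1 =
    binratio N.+1 k - binratio N.+1 k * ((k + k.+1)%:R / (N.+1 + k.+1)%:R).
  apply: (mulfI (lt0r_neq0 d0)); rewrite e; field; rewrite ?natrD -?natr1 in d0 *.
  by rewrite lt0r_neq0.
have le1 : binratio N.+1 k * ((k + k.+1)%:R / (N.+1 + k.+1)%:R) <=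
    (k + k.+1)%:R / N.+1%:R.
  apply: (@le_trans _ _ ((k + k.+1)%:R / (N.+1 + k.+1)%:R)).
    by rewrite ler_piMl ?divr_ge0// binratio_le1.
  by rewrite ler_wpM2l// lef_pV2 ?posrE// ler_nat leq_addr.
have -> : k.+1%:R ^+ 2 / N.+1%:R =
    k%:R ^+ 2 / N.+1%:R + (k + k.+1)%:R / N.+1%:R :> R.
  by rewrite natrD -!natr1; ring.
by rewrite opprD addrA; exact: lerB.
Qed.

(** From 1 - k^2 / N <= binratio N k <= 1. *)
Lemma cvg_binratio k : binratio^~ k @ \oo --> (1 : R).
Proof.
rewrite -(cvg_shiftS (binratio^~ k)).
apply: (@squeeze_cvgr _ _ _ _ (fun N => 1 - k%:R ^+ 2 / N.+1%:R) (fun=> 1)).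
- by near=> N; rewrite binratio_lb binratio_le1.
- rewrite -[X in _ --> X]subr0; apply: cvgB; first exact: cvg_cst.
  rewrite -[X in _ --> X](mulr0 (k%:R ^+ 2)); apply: cvgMl_tmp.
  exact: cvg_harmonic.
- exact: cvg_cst.
Unshelve. all: by end_near. Qed.

(** Only the lowest index k = m is not doubled. *)
Lemma sum_pow2_Delta m n (x : nat -> R) : (m < n)%N ->
  \sum_(m <= k < n) x k * 2 ^+ Delta k m = 2 * (\sum_(m <= k < n) x k) - x m.
Proof.
move=> mn; rewrite big_ltn// [in RHS]big_ltn// /Delta eqxx expr0 mulr1.
suff -> : \sum_(m.+1 <= k < n) x k * 2 ^+ (if k == m then 0%N else 1%N) =
    2 * \sum_(m.+1 <= k < n) x k by ring.
rewrite mulr_sumr; apply: eq_big_nat => k /andP[mk _].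
by rewrite gtn_eqF// expr1 mulrC.
Qed.

(** The case of a block with exponent 1. It telescopes because
    2 k b_k = (N + k) b_k - (N + k + 1) b_{k+1}, where b_k = binratio N k. *)
Lemma sum_binratio_linear N m : (m <= N)%N ->
  \sum_(m <= k < N.+1) binratio N k * k%:R * 2 ^+ Delta k m =
  N%:R * binratio N m.
Proof.
move=> mN; rewrite sum_pow2_Delta//.
rewrite mulr_sumr.
rewrite (@telescope_tail _ _ _ _ (fun k => (N + k)%:R * binratio N k)).
- by rewrite natrD; ring.
- lia.
- by rewrite binratio_small ?mulr0.
- by move=> k _; rewrite binratioS natrD; ring.
Qed.

(** The case of a block with exponent 3. It telescopes because
    2 N b_k = (N + k) b_k + (N + k + 1) b_{k+1}, where b_k = binratio N k. *)
Lemma sum_binratio_alternating N m : (0 < N)%N -> (m <= N)%N ->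
  \sum_(m <= k < N.+1) (-1) ^+ k * binratio N k * 2 ^+ Delta k m =
  (-1) ^+ m * m%:R * binratio N m / N%:R.
Proof.
move=> N0 mN; rewrite sum_pow2_Delta//.
have N0' : N%:R != 0 :> R by rewrite pnatr_eq0; lia.
rewrite mulr_sumr.
rewrite (@telescope_tail _ _ _ _
  (fun k => (-1) ^+ k * ((N + k)%:R * binratio N k) / N%:R)).
- by rewrite natrD; field.
- lia.
- by rewrite binratio_small ?mulr0 ?mul0r.
- by move=> k _; rewrite binratioS natrD exprS; field.
Qed.

(** Exchanging the summation over k with that over the outermost index l of the
    sharp sum, so that a sum over k with the doubling factor at l comes first. *)
Lemma sum_sharp_ones (f : nat -> R) N m r : (m <= N)%N -> (0 < m)%N ->
  \sum_(m <= k < N.+1) f k * sharp R k m (nseq r.+1 1%N) =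
  \sum_(m <= l < N.+1)
    (\sum_(l <= k < N.+1) f k * 2 ^+ Delta k l) / l%:R * sharp R l m (nseq r 1%N).
Proof.
move=> mN m0; transitivity (\sum_(m <= k < N.+1) \sum_(m <= l < k.+1)
    f k * 2 ^+ Delta k l / l%:R * sharp R l m (nseq r 1%N)).
  apply: eq_big_nat => k /andP[mk _]; rewrite sharp_cons// mulr_sumr.
  by apply: eq_bigr => l _; rewrite expr1; ring.
rewrite exchange_big_triangle; apply: eq_bigr => l _.
by rewrite !mulr_suml.
Qed.

(** The case of a block with exponent r + 3. Each of the r + 1 summations
    contributes a factor l / N, by [sum_binratio_alternating], and the weight
    1 / l of the next index of the sharp sum cancels l. *)
Lemma sum_binratio_sharp N m r : (0 < m <= N)%N ->
  \sum_(m <= k < N.+1) (-1) ^+ k * binratio N k * sharp R k m (nseq r 1%N) =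
  (-1) ^+ m * m%:R * binratio N m / N%:R ^+ r.+1.
Proof.
move=> /andP[m0 mN]; have N0' : N%:R != 0 :> R by rewrite pnatr_eq0; lia.
elim: r => [|r IH].
  by rewrite expr1 -sum_binratio_alternating//; lia.
rewrite sum_sharp_ones// exprS invfM mulrA mulrAC -IH mulr_suml.
apply: eq_big_nat => l /andP[ml lN].
rewrite sum_binratio_alternating; [|lia|lia].
have l0 : l%:R != 0 :> R by rewrite pnatr_eq0; lia.
by field; rewrite N0'.
Qed.

(** By comparison with the telescoping series of 2 / (k (k + 1)). *)
Lemma sum_invsq_le m n : (0 < m)%N -> \sum_(m <= k < n) k%:R ^- 2 <= 2 / m%:R :> R.
Proof.
move=> m0; have [mn|nm] := leqP m n; last first.
  by rewrite big_geq ?divr_ge0//; lia.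
apply: (@le_trans _ _ (- \sum_(m <= k < n) (2 / k.+1%:R - 2 / k%:R))).
  rewrite -sumrN; apply: ler_sum_nat => k /andP[mk _].
  have k0 : 1 <= k%:R :> R by rewrite ler1n; lia.
  rewrite opprB -[k.+1%:R]natr1 [leRHS](_ : _ = 2 / (k%:R * (k%:R + 1))); last first.
    by field; lra.
  rewrite ler_pdivlMr; last nra.
  by rewrite mulrC ler_pdivrMr; nra.
by rewrite (telescope_sumr (fun k => 2 / k%:R))// opprB gerBl divr_ge0.
Qed.

(** A sharp sum over a string of ones costs only a constant: summed against
    k^-2 from l on, the doubling factors give at most 4 / l, and 1 / l times this
    is again a multiple of l^-2. *)
Lemma sum_invsq_sharp_le N m r : (0 < m <= N)%N ->
  \sum_(m <= k < N.+1) k%:R ^- 2 * sharp R k m (nseq r 1%N) <= 4 ^+ r.+1 / m%:R.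
Proof.
have D2 (n l : nat) : (0 < l)%N ->
    \sum_(l <= k < n) k%:R ^- 2 * 2 ^+ Delta k l <= 4 / l%:R :> R.
  move=> l0; apply: (@le_trans _ _ (2 * \sum_(l <= k < n) k%:R ^- 2)).
    rewrite mulr_sumr; apply: ler_sum => k _; rewrite mulrC ler_wpM2r//.
    by rewrite /Delta; case: ifP => _; rewrite ?expr0 ?expr1 ?ler1n.
  by have := sum_invsq_le n l0; lra.
move=> /andP[m0 mN]; elim: r => [|r IH].
  by rewrite expr1; exact: D2.
rewrite sum_sharp_ones// exprS -mulrA.
apply: le_trans (ler_wpM2l _ IH) => //; rewrite mulr_sumr.
apply: ler_sum_nat => l /andP[ml lN].
have l0 : 0 < l%:R :> R by rewrite ltr0n; lia.
rewrite mulrA; apply: ler_wpM2r; first exact: sharp_ge0.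
rewrite ler_pdivrMr//; apply: le_trans (D2 _ _ _) _; first lia.
by rewrite le_eqVlt; apply/orP; left; apply/eqP; field; rewrite lt0r_neq0.
Qed.

End BinomialRatio.

(** * The finite identity *)

Section FiniteIdentity.
Variable R : realType.

Definition sgn_nat (k : nat) : R := (-1) ^+ k * k%:R.

(** The part of a summand that depends on c only: kp is the index that precedes
    the chain k, and c starts with the exponent between kp and the first index
    of k. Beyond its end c continues with 1, the exponent that closes the string. *)
Definition sharp_kernel (kp : nat) (c k : seq nat) : R :=
  \prod_(i < size k)
    (sgn_nat (nth 0 k i)%N ^+ (delta (nth 1 c i)%N + delta (nth 1 c i.+1)%N)
     * sharp R (nth 0 (kp :: k) i)%N (nth 0 k i)%N (nseq (nth 1 c i - 3)%N 1%N)).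

(** Each index carries a cube besides the squares counted by a, since the
    coefficients of the powers of z_i^2 in 1 / (k (k^2 - z_i^2)) are the
    k^-(3 + 2 n). *)
Definition pow_weight (a k : seq nat) : R :=
  \prod_(i < size k) (nth 0 k i)%:R ^- (3 + 2 * nth 0 a i)%N.

Definition zargs (a0 : nat) (c a : seq nat) : seq nat :=
  nseq a0 2 ++ flatten [seq p.1 :: nseq p.2 2 | p <- zip c a] ++ [:: 1%N].

Lemma sharp_kernel_nil kp c : sharp_kernel kp c [::] = 1.
Proof. by rewrite /sharp_kernel big_ord0. Qed.

Lemma sharp_kernel_cons kp c0 c k0 k :
  sharp_kernel kp (c0 :: c) (k0 :: k) =
  sgn_nat k0 ^+ (delta c0 + delta (nth 1 c 0)%N)
  * sharp R kp k0 (nseq (c0 - 3) 1%N) * sharp_kernel k0 c k.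
Proof. by rewrite /sharp_kernel big_ord_recl. Qed.

Lemma pow_weight_nil a : pow_weight a [::] = 1.
Proof. by rewrite /pow_weight big_ord0. Qed.

Lemma pow_weight_behead a k0 k : pow_weight a (k0 :: k) =
  k0%:R ^- (3 + 2 * nth 0 a 0)%N * pow_weight (behead a) k.
Proof.
rewrite /pow_weight big_ord_recl/=; congr (_ * _).
by apply: eq_bigr => i _; rewrite nth_behead.
Qed.

Lemma binratio_sum_step N (h : nat -> R) :
  \sum_(1 <= k < N.+2) binratio R N.+1 k * h k =
  \sum_(1 <= k < N.+1) binratio R N k * h k +
  N.+1%:R ^- 2 * \sum_(1 <= k < N.+2) binratio R N.+1 k * (k%:R ^+ 2 * h k).
Proof.
have -> : \sum_(1 <= k < N.+1) binratio R N k * h k =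
    \sum_(1 <= k < N.+2) binratio R N k * h k.
  by rewrite [RHS]big_nat_recr//= binratio_small// mul0r addr0.
rewrite mulr_sumr -big_split/=; apply: eq_bigr => k _.
have N0 : N.+1%:R != 0 :> R by rewrite pnatr_eq0.
have e : binratio R N k = binratio R N.+1 k * (N.+1%:R ^+ 2 - k%:R ^+ 2) / N.+1%:R ^+ 2.
  by rewrite binratio_pred mulrC mulKf// expf_neq0.
by rewrite e; field.
Qed.

(** Summing out the outermost index k replaces a block with exponent c by the
    power N^-c: by [sum_binratio_linear] for c = 1, by [sum_binratio_sharp] for
    larger c. *)
Lemma sum_binratio_kernel N c l : (0 < l <= N)%N -> (0 < c)%N -> c != 2%N ->
  \sum_(l <= k < N.+1) binratio R N k *
     (sgn_nat k ^+ (delta 1 + delta c) / k%:R * sharp R k l (nseq (c - 3) 1%N))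
  * sgn_nat l ^+ delta c =
  N%:R ^+ 2 / N%:R ^+ c * (binratio R N l * sgn_nat l).
Proof.
move=> /andP[l0 lN]; have N0 : N%:R != 0 :> R by rewrite pnatr_eq0; lia.
case: c => [//|[|[//|r]]] _ _.
  rewrite /= -mulr_suml expr1 -[RHS]mulrA.
  transitivity (N%:R * binratio R N l * sgn_nat l); last by field.
  congr (_ * _); rewrite -sum_binratio_linear//; apply: eq_big_nat => k lk.
  have k0 : k%:R != 0 :> R by rewrite pnatr_eq0; lia.
  rewrite sharp_nil /sgn_nat exprMn sqrr_sign mul1r.
  by field.
rewrite /= subSS subSS subSS subn0.
transitivity (\sum_(l <= k < N.+1)
    (-1) ^+ k * binratio R N k * sharp R k l (nseq r 1%N)).
  apply: eq_big_nat => k lk; rewrite addn0 expr1 expr0 mulr1 /sgn_nat mulfK.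
    by ring.
  by rewrite pnatr_eq0; lia.
rewrite sum_binratio_sharp ?l0// /sgn_nat !exprS.
by field; rewrite N0 expf_neq0.
Qed.

Definition kernel_sum (c a : seq nat) (k : nat) : R :=
  \sum_(l <- chains (size c) k) sharp_kernel k c l * pow_weight a l.

(** The sum over all chains with outermost index k; the factor 2 is the doubling
    factor between 0 and k. *)
Definition kernel_head (a0 : nat) (c a : seq nat) (k : nat) : R :=
  2 * sgn_nat k ^+ (delta 1 + delta (nth 1 c 0)%N) * k%:R ^- (3 + 2 * a0)
    * kernel_sum c a k.

Lemma kernel_sum_nil a k : kernel_sum [::] a k = 1.
Proof.
by rewrite /kernel_sum big_seq1 sharp_kernel_nil pow_weight_nil mulr1.
Qed.

Lemma kernel_sum_cons c0 c a0 a k :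
  kernel_sum (c0 :: c) (a0 :: a) k =
  \sum_(1 <= l < k.+1) sgn_nat l ^+ (delta c0 + delta (nth 1 c 0)%N)
    * sharp R k l (nseq (c0 - 3) 1%N) * l%:R ^- (3 + 2 * a0) * kernel_sum c a l.
Proof.
rewrite /kernel_sum sum_chainsS; apply: eq_bigr => l _.
rewrite mulr_sumr; apply: eq_bigr => m _.
by rewrite sharp_kernel_cons pow_weight_behead; ring.
Qed.

Lemma sharp_kernel_head a0 c a N (f : nat -> R) :
  \sum_(k <- chains (size c).+1 N)
    f (head 0%N k) * (sharp_kernel 0 (1%N :: c) k * pow_weight (a0 :: a) k) =
  \sum_(1 <= k < N.+1) f k * kernel_head a0 c a k.
Proof.
rewrite sum_chainsS; apply: eq_big_nat => k /andP[k0 _].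
rewrite /kernel_head /kernel_sum mulr_sumr mulr_sumr; apply: eq_bigr => l _.
rewrite sharp_kernel_cons pow_weight_behead /= sharp_nil /Delta.
by rewrite ltn_eqF// expr1; ring.
Qed.

Lemma sum_kernel_head_nil a N :
  \sum_(1 <= k < N.+2) binratio R N.+1 k * (k%:R ^+ 2 * kernel_head 0 [::] a k) =
  N.+1%:R.
Proof.
transitivity (2 * \sum_(1 <= k < N.+2) binratio R N.+1 k * k%:R).
  rewrite mulr_sumr; apply: eq_big_nat => k k1.
  have k0 : k%:R != 0 :> R by rewrite pnatr_eq0; lia.
  rewrite /kernel_head kernel_sum_nil/= /sgn_nat exprMn sqrr_sign.
  by field.
have := @sum_binratio_linear R N.+1 0 isT.
rewrite big_ltn// mulr0 mul0r add0r binratio0 mulr1 => <-.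
rewrite mulr_sumr; apply: eq_big_nat => k /andP[k1 _].
by rewrite /Delta gtn_eqF// expr1 mulrC.
Qed.

Lemma sum_kernel_head_cons c0 c a0 a N : (0 < c0)%N -> c0 != 2%N ->
  \sum_(1 <= k < N.+2)
    binratio R N.+1 k * (k%:R ^+ 2 * kernel_head 0 (c0 :: c) (a0 :: a) k) =
  N.+1%:R ^+ 2 / N.+1%:R ^+ c0 *
  \sum_(1 <= k < N.+2) binratio R N.+1 k * kernel_head a0 c a k.
Proof.
move=> c00 c02.
transitivity (\sum_(1 <= k < N.+2) \sum_(1 <= l < k.+1)
   binratio R N.+1 k * (sgn_nat k ^+ (delta 1 + delta c0) / k%:R *
     sharp R k l (nseq (c0 - 3) 1%N)) * sgn_nat l ^+ delta c0 *
   (2 * sgn_nat l ^+ (delta (nth 1 c 0)%N) * l%:R ^- (3 + 2 * a0)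
      * kernel_sum c a l)).
  apply: eq_big_nat => k k1; rewrite /kernel_head kernel_sum_cons/=.
  have k0 : k%:R != 0 :> R by rewrite pnatr_eq0; lia.
  rewrite !mulr_sumr; apply: eq_bigr => l _.
  rewrite muln0 addn0 [sgn_nat l ^+ _]exprD.
  by move: (l%:R ^- _) => L; field.
rewrite exchange_big_triangle mulr_sumr; apply: eq_big_nat => l l1.
rewrite -mulr_suml sum_binratio_kernel; [|lia|lia|done].
rewrite /kernel_head [delta 1]/= add1n [sgn_nat l ^+ _.+1]exprS; ring.
Qed.

Lemma kernel_headS a0 c a k : (0 < k)%N ->
  k%:R ^+ 2 * kernel_head a0.+1 c a k = kernel_head a0 c a k.
Proof.
move=> k1; have k0 : k%:R != 0 :> R by rewrite pnatr_eq0; lia.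
rewrite /kernel_head mulnS addnCA [k%:R ^+ (2 + _)]exprD invfM.
by move: (k%:R ^- (3 + _)) => w; field.
Qed.

(** The truncated zeta-star value as a sharp-type sum. Both sides have the same
    increment from N to N + 1: if the string starts with 2, because of
    [binratio_pred]; if it starts with an exponent c1 other than 2, because of
    [sum_binratio_kernel], which turns the increment into the same identity for
    the shorter string. *)
Lemma tzeta_zargs a0 c a N : size a = size c ->
  all (fun x => (0 < x)%N && (x != 2%N)) c ->
  tzeta R (zargs a0 c a) N =
  \sum_(1 <= k < N.+1) binratio R N k * kernel_head a0 c a k.
Proof.
(* one more leading 2 in the string is one more factor k^-2 in the kernel *)
have stepS b0 d b N0 s :
    (forall M, tzeta R s M =
      \sum_(1 <= k < M.+1) binratio R M k * kernel_head b0 d b k) ->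
    tzeta R (2 :: s) N0 =
    \sum_(1 <= k < N0.+1) binratio R N0 k * kernel_head b0.+1 d b k.
  move=> IHs; elim: N0 => [|M IH]; first by rewrite tzeta_cons0 big_geq.
  rewrite tzeta_consS binratio_sum_step -IH IHs; congr (_ + _ * _).
  by apply: eq_big_nat => k k1; rewrite kernel_headS//; lia.
elim: c a0 a N => [|c1 c IHc] a0 a N.
  case: a => // _ _.
  elim: a0 N => [|a0 IHa] N; last exact: stepS.
  elim: N => [|N IH]; first by rewrite tzeta_cons0 big_geq.
  rewrite /zargs/= tzeta_consS tzeta_nil mulr1.
  rewrite binratio_sum_step sum_kernel_head_nil -IH; congr (_ + _).
  by rewrite expr1 expr2 invfM -mulrA mulVf ?pnatr_eq0// mulr1.
case: a => // a1 a [sa] /=/andP[/andP[c10 c12] call].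
elim: a0 N => [|a0 IHa] N; last exact: stepS.
elim: N => [|N IH]; first by rewrite tzeta_cons0 big_geq.
rewrite /zargs/= tzeta_consS binratio_sum_step sum_kernel_head_cons//.
rewrite -IH; congr (_ + _); rewrite -IHc// /zargs -catA.
have N0 : N.+1%:R != 0 :> R by rewrite pnatr_eq0.
by rewrite -mulrA mulKf ?expf_neq0.
Qed.

End FiniteIdentity.

(** * Uniform bounds *)

Section KernelBounds.
Variable R : realType.

Lemma pow_weight_ge0 a k : 0 <= pow_weight R a k.
Proof. by apply: prodr_ge0 => i _; rewrite invr_ge0 exprn_ge0. Qed.

Lemma pow_weight_anti a b k : all (leq 1) k ->
  (forall i, nth 0 b i <= nth 0 a i)%N -> pow_weight R a k <= pow_weight R b k.
Proof.
move=> /all_nthP k1 ba; apply: ler_prod => i _.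
rewrite invr_ge0 exprn_ge0//= lef_pV2 ?posrE ?exprn_gt0 ?ltr0n ?(k1 0)//.
apply: ler_weXn2l; first by rewrite ler1n (k1 0).
by rewrite leq_add2l leq_mul2l ba orbT.
Qed.

Lemma norm_sgn_nat k : `|sgn_nat R k| = k%:R.
Proof. by rewrite /sgn_nat normrM normrX normrN1 expr1n mul1r normr_nat. Qed.

Definition abs_kernel_sum (c a : seq nat) (k : nat) : R :=
  \sum_(l <- chains (size c) k) `|sharp_kernel R k c l| * pow_weight R a l.

Lemma abs_kernel_sum_ge0 c a k : 0 <= abs_kernel_sum c a k.
Proof. by apply: sumr_ge0 => l _; rewrite mulr_ge0// pow_weight_ge0. Qed.

Lemma abs_kernel_sum_cons c0 c a k :
  abs_kernel_sum (c0 :: c) a k =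
  \sum_(1 <= l < k.+1) l%:R ^+ (delta c0 + delta (nth 1%N c 0))
    * sharp R k l (nseq (c0 - 3) 1%N) * l%:R ^- (3 + 2 * nth 0 a 0)%N
    * abs_kernel_sum c (behead a) l.
Proof.
rewrite /abs_kernel_sum sum_chainsS; apply: eq_bigr => l _.
rewrite mulr_sumr; apply: eq_bigr => m _.
rewrite sharp_kernel_cons pow_weight_behead !normrM normrX norm_sgn_nat.
by rewrite (ger0_norm (sharp_ge0 _ _ _ _)); ring.
Qed.

Lemma delta_le1 n : (0 < n)%N -> (delta n <= 1)%N.
Proof. by case: n => [//|[|[]]]. Qed.

Lemma expr_div_le (k i j n : nat) : (0 < k)%N -> (i + n <= j)%N ->
  k%:R ^+ i * k%:R ^- j <= k%:R ^- n :> R.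
Proof.
move=> k0 inj; have kn0 p : k%:R ^+ p != 0 :> R.
  by rewrite expf_neq0// pnatr_eq0; lia.
have -> : k%:R ^- n = k%:R ^+ i * k%:R ^- (i + n) :> R.
  by rewrite exprD invfM mulVKf.
rewrite ler_wpM2l ?exprn_ge0// lef_pV2 ?posrE ?exprn_gt0 ?ltr0n//.
by rewrite ler_weXn2l// ler1n.
Qed.

(** The weight k^-2 at the outermost index passes down the chain: summing over
    that index leaves 1 / l at the next one by [sum_invsq_sharp_le], where the
    kernel and the power weight provide at least one further factor 1 / l. *)
Lemma abs_kernel_sum_bound c a : all (leq 1) c ->
  exists B : R, forall N, \sum_(1 <= k < N.+1) k%:R ^- 2 * abs_kernel_sum c a k <= B.
Proof.
elim: c a => [|c0 c IH] a /=.
  move=> _; exists 2 => N.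
  rewrite (_ : \sum_(1 <= k < N.+1) _ = \sum_(1 <= k < N.+1) k%:R ^- 2).
    by have := sum_invsq_le R N.+1 (ltn0Sn 0); rewrite divr1.
  apply: eq_bigr => k _; rewrite /abs_kernel_sum big_seq1 sharp_kernel_nil.
  by rewrite pow_weight_nil normr1 !mulr1.
move=> /andP[c00 c1]; have [B HB] := IH (behead a) c1.
exists (4 ^+ (c0 - 3).+1 * B) => N.
apply: le_trans (ler_wpM2l _ (HB N)); last exact: exprn_ge0.
have -> : \sum_(1 <= k < N.+1) k%:R ^- 2 * abs_kernel_sum (c0 :: c) a k =
  \sum_(1 <= k < N.+1) \sum_(1 <= l < k.+1)
    k%:R ^- 2 * sharp R k l (nseq (c0 - 3) 1%N) *
    (l%:R ^+ (delta c0 + delta (nth 1%N c 0)) * l%:R ^- (3 + 2 * nth 0 a 0)%N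
      * abs_kernel_sum c (behead a) l).
  apply: eq_bigr => k _; rewrite abs_kernel_sum_cons mulr_sumr.
  by apply: eq_bigr => l _; ring.
rewrite exchange_big_triangle mulr_sumr; apply: ler_sum_nat => l lN.
rewrite -mulr_suml.
have l0 : l%:R != 0 :> R by rewrite pnatr_eq0; lia.
have -> : 4 ^+ (c0 - 3).+1 * (l%:R ^- 2 * abs_kernel_sum c (behead a) l) =
    4 ^+ (c0 - 3).+1 / l%:R * (l%:R ^- 1 * abs_kernel_sum c (behead a) l).
  by rewrite expr1 expr2 invfM; ring.
apply: ler_pM.
- by apply: sumr_ge0 => k _; rewrite mulr_ge0 ?sharp_ge0.
- by rewrite !mulr_ge0 ?abs_kernel_sum_ge0 ?invr_ge0 ?exprn_ge0.
- by apply: sum_invsq_sharp_le; lia.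
apply: ler_wpM2r; first exact: abs_kernel_sum_ge0.
apply: expr_div_le; first lia.
have nc : (0 < nth 1%N c 0)%N by case: (c) c1 => //= x s /andP[].
by have := delta_le1 c00; have := delta_le1 nc; lia.
Qed.

(** The requirement on c1 is what makes the outermost index summable: when no
    additional square sits at position 0, the exponent 1 + delta c1 - 3 has to be
    at most -2. *)
Lemma chain_sum_bound c a m : all (leq 1) c -> (0 < nth 0 a m)%N ->
  ((0 < m)%N -> (3 <= nth 1 c 0)%N) ->
  exists B : R, forall N, \sum_(k <- chains (size c).+1 N)
    `|sharp_kernel R 0 (1%N :: c) k| * pow_weight R a k <= B.
Proof.
move=> c1 am mc; have [B HB] := abs_kernel_sum_bound (behead a) c1.
exists (2 * B) => N; apply: le_trans (ler_wpM2l _ (HB N)); last by [].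
rewrite sum_chainsS mulr_sumr; apply: ler_sum_nat => k k1.
have -> : \sum_(l <- chains (size c) k) `|sharp_kernel R 0 (1%N :: c) (k :: l)|
      * pow_weight R a (k :: l) =
    2 * (k%:R ^+ (delta 1 + delta (nth 1%N c 0)) * k%:R ^- (3 + 2 * nth 0 a 0)%N)
      * abs_kernel_sum c (behead a) k.
  rewrite /abs_kernel_sum mulr_sumr; apply: eq_bigr => l _.
  rewrite sharp_kernel_cons pow_weight_behead !normrM normrX norm_sgn_nat.
  rewrite sharp_nil /Delta ltn_eqF; last lia.
  by rewrite expr1 normr_nat; ring.
rewrite [leRHS]mulrA; apply: ler_wpM2r; first exact: abs_kernel_sum_ge0.
apply: ler_wpM2l => //; apply: expr_div_le; first lia.
have nc : (0 < nth 1%N c 0)%N by case: (c) c1 => //= x s /andP[].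
case: m am mc => [a0 _|m _ /(_ isT)].
  by have := delta_le1 nc; rewrite /=; lia.
by case: (nth 1%N c 0) => [|[|[]]]//= n _; lia.
Qed.

End KernelBounds.

(** * Dominated convergence and sums over tuples *)

Lemma sum_fset_seq (V : nmodType) (T : choiceType) (s : seq T) (F : T -> V) :
  uniq s -> \sum_(t <- [fset t in s]%fset) F t = \sum_(t <- s) F t.
Proof. by move=> us; rewrite big_imfset//= undup_id. Qed.

(** Tannery's theorem with the summability of the limit family f derived from
    the domination. *)
Lemma dominated_convergence_sum (R : realType) (I : choiceType)
    (fN : nat -> I -> R[i]) (f : I -> R[i]) (g : I -> R) (B : R)
    (sN : nat -> R[i]) :
  (forall N i, `|fN N i| <= (g i)%:C%C) -> (forall i, `|f i| <= (g i)%:C%C) ->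
  (forall J : {fset I}, \sum_(i <- J) g i <= B) ->
  (forall i, (fN^~ i : nat -> R[i]^o) @ \oo --> (f i : R[i]^o)) ->
  (forall N, has_sum predT (fN N) (sN N)) ->
  exists s, has_sum predT f s /\ (sN : nat -> R[i]^o) @ \oo --> (s : R[i]^o).
Proof.
move=> fNg fg gB fNf fNs.
have g0 i : 0 <= g i.
  by rewrite -lecR; apply: le_trans (fg i); exact: normr_ge0.
have [s fs] := complex_summable fg gB.
have [G gG] := nonneg_summable g0 gB.
exists s; split => //.
exact: (tannery fNg (has_sum_real_complex gG) fNf fNs fs).
Qed.

Section TupleBox.
Variable n : nat.

Definition box_seq (N : nat) : seq (n.-tuple nat) :=
  [seq [tuple (f j : nat) | j < n] | f : {ffun 'I_n -> 'I_N}].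

Lemma box_seq_uniq N : uniq (box_seq N).
Proof.
rewrite map_inj_uniq ?enum_uniq// => f g fg; apply/ffunP => j.
by apply: val_inj; have := congr1 (fun t => tnth t j) fg; rewrite !tnth_mktuple.
Qed.

Lemma mem_box_seq N (t : n.-tuple nat) :
  (t \in box_seq N) = [forall j, tnth t j < N]%N.
Proof.
apply/mapP/forallP => [[f _ ->] j|tN]; first by rewrite tnth_mktuple.
exists [ffun j => Ordinal (tN j)]; rewrite ?mem_enum//; apply: eq_from_tnth => j.
by rewrite tnth_mktuple ffunE.
Qed.

Lemma sum_box (V : comPzRingType) (g : 'I_n -> nat -> V) N :
  \sum_(t <- box_seq N) \prod_(j < n) g j (tnth t j) =
  \prod_(j < n) \sum_(i < N) g j i.
Proof.
rewrite bigA_distr_bigA/= big_image/=; apply: eq_bigr => f _.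
by apply: eq_bigr => j _; rewrite tnth_mktuple.
Qed.

Lemma fset_sub_box (J : {fset n.-tuple nat}) : exists N,
  (J `<=` [fset t in box_seq N])%fset.
Proof.
exists (\max_(t <- J) \max_(j < n) (tnth t j).+1)%N; apply/fsubsetP => t tJ.
rewrite inE/= mem_box_seq; apply/forallP => j.
apply: (@leq_trans (\max_(j < n) (tnth t j).+1)%N).
  exact: (leq_bigmax (F := fun j => (tnth t j).+1)).
by apply: (leq_bigmax_seq (F := fun t : n.-tuple nat => \max_(j < n) (tnth t j).+1)%N).
Qed.

Lemma prod_summable (R : realType) (b : 'I_n -> nat -> R) (B : 'I_n -> R) :
  (forall j i, 0 <= b j i) -> (forall j N, \sum_(i < N) b j i <= B j) ->
  forall J : {fset n.-tuple nat},
    \sum_(t <- J) \prod_(j < n) b j (tnth t j) <= \prod_(j < n) B j.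
Proof.
move=> b0 bB J; have [N JN] := fset_sub_box J.
apply: (@le_trans _ _ (\sum_(t <- [fset t in box_seq N]%fset)
    \prod_(j < n) b j (tnth t j))).
  by rewrite (sum_fsetD _ JN) lerDl sumr_ge0// => t _; apply: prodr_ge0.
rewrite sum_fset_seq ?box_seq_uniq// sum_box; apply: ler_prod => j _.
by apply/andP; split; [exact: sumr_ge0|exact: bB].
Qed.

(** Sums over boxes factor into one-variable sums, and the boxes exhaust all
    tuples. *)
Lemma has_sum_prod (R : realType) (g : 'I_n -> nat -> R[i])
    (b : 'I_n -> nat -> R) (B : 'I_n -> R) (G : 'I_n -> R[i]) :
  (forall j i, `|g j i| <= (b j i)%:C%C) ->
  (forall j N, \sum_(i < N) b j i <= B j) ->
  (forall j, (fun N => \sum_(i < N) g j i : R[i]^o) @ \oo --> (G j : R[i]^o)) ->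
  has_sum predT (fun t : n.-tuple nat => \prod_(j < n) g j (tnth t j))
    (\prod_(j < n) G j).
Proof.
move=> gb bB gG.
have b0 j i : 0 <= b j i.
  by rewrite -lecR; apply: le_trans (gb j i); exact: normr_ge0.
pose f (t : n.-tuple nat) : R[i] := \prod_(j < n) g j (tnth t j).
pose fN N t := if t \in box_seq N then f t else 0.
have fb t : `|f t| <= (\prod_(j < n) b j (tnth t j))%:C%C.
  by rewrite normr_prod rmorph_prod/=; apply: ler_prod => j _; rewrite normr_ge0/=.
have [|t|N|s [fs sNs]] := @dominated_convergence_sum R _ fN f _ _
    (fun N => \sum_(t <- box_seq N) f t) _ fb (prod_summable b0 bB).
- move=> N t; rewrite /fN; case: ifP => // _; rewrite normr0 -[0]/(0%:C%C) lecR.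
  exact: prodr_ge0.
- apply: cvg_near_cst.
  have [N0] := fset_sub_box [fset t]%fset.
  rewrite fsub1set inE/= mem_box_seq => /forallP tN0.
  exists N0 => // N /= NN0; rewrite /fN mem_box_seq.
  by case: forallP => // -[] j; exact: leq_trans NN0.
- rewrite (_ : \sum_(t <- box_seq N) f t =
      \sum_(t <- [fset t in box_seq N]%fset) fN N t).
    by apply: has_sum_finsupp => t; rewrite inE/= /fN => /negbTE ->.
  rewrite sum_fset_seq ?box_seq_uniq//; apply: eq_big_seq => t tN.
  by rewrite /fN tN.
suff -> : \prod_(j < n) G j = s by [].
have sNG : (fun N => \sum_(t <- box_seq N) f t : R[i]^o) @ \oo -->
    (\prod_(j < n) G j : R[i]^o).
  under eq_fun do rewrite sum_box.
  apply: cvg_big => [|j _]; first exact: mul_continuous.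
  exact: gG.
exact: cvg_seq_unique sNG sNs.
Qed.

End TupleBox.

(** * Geometric series and chains as tuples *)

Section Geometric.
Variable R : realType.
Implicit Types x : R[i].

Definition realnorm x : R := complex.Re `|x|.

Lemma realnormE x : `|x| = (realnorm x)%:C%C.
Proof. by rewrite /realnorm RRe_real// normr_real. Qed.

Lemma realnorm_ge0 x : 0 <= realnorm x.
Proof. by rewrite -lecR -realnormE; exact: normr_ge0. Qed.

Lemma realnorm_lt1 x : `|x| < 1 -> realnorm x < 1.
Proof. by rewrite realnormE -[1]/(1%:C%C) ltcR. Qed.

Lemma cvg_real_complex (u : nat -> R) (l : R) : u @ \oo --> l ->
  (fun N => (u N)%:C%C : R[i]^o) @ \oo --> (l%:C%C : R[i]^o).
Proof.
move=> ul; apply/cvgrPdist_le => e; rewrite ltcE/= => /andP[/eqP ie re].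
move/cvgrPdist_le : ul => /(_ _ re); apply: filterS => N.
rewrite -rmorphB/= normc_real -lecR => /le_trans; apply.
by rewrite lecE/= ie eqxx lexx.
Qed.

Lemma cvg_complex_expr x : `|x| < 1 ->
  (fun N => x ^+ N : R[i]^o) @ \oo --> (0 : R[i]^o).
Proof.
move=> x1; apply/norm_cvg0P.
under eq_fun do rewrite normrX realnormE -rmorphXn/=.
apply: (@cvg_real_complex _ 0); apply: cvg_expr.
by rewrite ger0_norm ?realnorm_ge0// realnorm_lt1.
Qed.

Lemma sum_geometric (F : fieldType) (x : F) N : x != 1 ->
  \sum_(i < N) x ^+ i = (1 - x ^+ N) / (1 - x).
Proof.
move=> x1; have x10 : 1 - x != 0 by rewrite subr_eq0 eq_sym.
by rewrite -[1 - x ^+ N]opprB subrX1; field.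
Qed.

Lemma cvg_geometric_series x : `|x| < 1 ->
  (fun N => \sum_(i < N) x ^+ i : R[i]^o) @ \oo --> ((1 - x)^-1 : R[i]^o).
Proof.
move=> x1; have xn1 : x != 1 by apply: contraTneq x1 => ->; rewrite normr1 ltxx.
under eq_fun do rewrite sum_geometric//.
have : (fun N => (1 - x ^+ N) / (1 - x) : R[i]^o) @ \oo -->
    ((1 - 0) / (1 - x) : R[i]^o).
  by apply: cvgMr_tmp; apply: cvgB; [exact: cvg_cst|exact: cvg_complex_expr].
by rewrite subr0 mul1r.
Qed.

Lemma geometric_le (r : R) N : 0 <= r -> r < 1 -> \sum_(i < N) r ^+ i <= (1 - r)^-1.
Proof.
move=> r0 r1; rewrite sum_geometric ?lt_eqF// ler_piMl ?gerBl ?exprn_ge0//.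
by rewrite invr_ge0 subr_ge0 ltW.
Qed.

(** The restriction to positive m-th exponents only shifts the m-th geometric
    series, which multiplies its sum by [x m]. *)
Lemma has_sum_geometric n (x : 'I_n -> R[i]) (m : 'I_n) :
  (forall j, `|x j| < 1) ->
  has_sum predT
    (fun a : n.-tuple nat =>
       if (0 < tnth a m)%N then \prod_(j < n) x j ^+ tnth a j else 0)
    (\prod_(j < n) ((if j == m then x j else 1) / (1 - x j))).
Proof.
move=> x1; pose g (j : 'I_n) i := if (j == m) && (i == 0)%N then 0 else x j ^+ i.
rewrite (_ : (fun a : n.-tuple nat => _) =
    (fun a => \prod_(j < n) g j (tnth a j))); last first.
  apply/funext => a; rewrite /g lt0n; case: eqP => /= [am|am].
    by apply/esym/eqP/prodf_eq0; exists m => //; rewrite am !eqxx.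
  by apply: eq_bigr => j _; case: eqP => //= ->; case: eqP.
apply: (@has_sum_prod _ _ g (fun j i => realnorm (x j) ^+ i)
    (fun j => (1 - realnorm (x j))^-1)) => [j i|j N|j].
- rewrite /g; case: ifP => _; last by rewrite normrX realnormE rmorphXn.
  by rewrite normr0 -[0]/(0%:C%C) lecR exprn_ge0// realnorm_ge0.
- by apply: geometric_le; [exact: realnorm_ge0|exact: realnorm_lt1].
rewrite /g; case: eqP => _ /=; last first.
  by rewrite mul1r; exact: cvg_geometric_series.
rewrite -(cvg_shiftS (fun N => \sum_(i < N) _ : R[i]^o)).
rewrite (_ : [sequence _]_N = fun N => x j * \sum_(i < N) x j ^+ i : R[i]^o).
  by apply: cvgMl_tmp; exact: cvg_geometric_series.
apply/funext => N /=; rewrite big_ord_recl/= add0r mulr_sumr.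
by apply: eq_bigr => i _; rewrite exprS.
Qed.

End Geometric.

Section ChainTuples.
Variable n : nat.

Definition chain_tuples (N : nat) : seq (n.-tuple nat) := pmap insub (chains n N).

Lemma chain_tuples_uniq N : uniq (chain_tuples N).
Proof. by rewrite pmap_sub_uniq// chains_uniq. Qed.

Lemma mem_chain_tuples N (t : n.-tuple nat) :
  (t \in chain_tuples N) = path geq N t && all (leq 1) t.
Proof. by rewrite mem_pmap_sub mem_chains size_tuple eqxx. Qed.

Lemma sum_chain_tuples (V : nmodType) (F : seq nat -> V) N :
  \sum_(t <- chain_tuples N) F t = \sum_(k <- chains n N) F k.
Proof.
have -> : chains n N = map val (chain_tuples N).
  rewrite pmap_filter; last exact: insubK.
  apply/esym/all_filterP/allP => k; rewrite mem_chains => /and3P[nk _ _].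
  by rewrite insubT.
by rewrite big_map.
Qed.

Lemma decr_pos_in_chains (J : {fset n.-tuple nat}) : exists N,
  forall t, t \in J -> decr_pos t -> t \in chain_tuples N.
Proof.
exists (\max_(t <- J) head 0 t)%N => t tJ /andP[st t1].
rewrite mem_chain_tuples t1 andbT.
have : (head 0 t <= \max_(t <- J) head 0 t)%N.
  by apply: (leq_bigmax_seq (F := fun t : n.-tuple nat => head 0 t)%N).
by case: (tval t) st => //= x s -> ->.
Qed.

Lemma chain_sum_le (R : realType) (F : seq nat -> R) (B : R) :
  (forall k, 0 <= F k) -> (forall N, \sum_(k <- chains n N) F k <= B) ->
  forall J : {fset n.-tuple nat},
    \sum_(t <- J) (if decr_pos t then F t else 0) <= B.
Proof.
move=> F0 FB J; have [N HN] := decr_pos_in_chains J.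
apply: le_trans (FB N); rewrite -sum_chain_tuples.
rewrite -big_mkcond/= big_fset_condE/=.
rewrite -(sum_fset_seq _ (chain_tuples_uniq N)).
rewrite [leRHS](@sum_fsetD _ _ _ [fset t in J | decr_pos t]%fset).
  by rewrite lerDl sumr_ge0.
by apply/fsubsetP => t; rewrite !inE/= => /andP[tJ dt]; exact: HN.
Qed.

End ChainTuples.

(** * The sharp summand *)

Section SharpTerm.
Variables (R : realType) (d : nat) (m : 'I_d.+1) (c : d.-tuple nat).
Variable z : 'I_d.+1 -> R[i].

Lemma sgn_nat_complex (n e : nat) : (0 < n)%N ->
  (-1) ^+ (n * e) * n%:R ^ (e%:Z - 1) = (sgn_nat R n ^+ e)%:C%C / n%:R :> R[i].
Proof.
move=> n0; have nn0 : n%:R != 0 :> R[i] by rewrite pnatr_eq0; lia.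
rewrite expfzDr// rmorphXn rmorphM rmorphXn rmorphN1 rmorph_nat.
by rewrite exprMn exprM mulrA.
Qed.

Lemma prod_ord_size (V : pzSemiRingType) (k : d.+1.-tuple nat) (F : nat -> V) :
  \prod_(i < size k) F i = \prod_(i < d.+1) F i.
Proof. by rewrite -!(big_mkord xpredT F) size_tuple. Qed.

Lemma tuple_gt0 (k : d.+1.-tuple nat) i : all (leq 1) k -> (0 < tnth k i)%N.
Proof. by move=> /allP; apply; exact: mem_tnth. Qed.

(** The summand splits into a real kernel, which depends on c only, and a
    factor with denominators, which depends on z only. *)
Lemma sharp_termE (k : d.+1.-tuple nat) : all (leq 1) k ->
  sharp_term m c z k = (sharp_kernel R 0 (1%N :: c) k)%:C%C *
    ((tnth k m)%:R ^- 2 *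
     \prod_(i < d.+1) ((tnth k i)%:R * ((tnth k i)%:R ^+ 2 - z i ^+ 2))^-1).
Proof.
move=> k1; rewrite mulrCA; congr (_ * _).
rewrite /sharp_kernel (prod_ord_size k (fun i => sgn_nat R (nth 0 k i)%N
  ^+ (delta (nth 1 (1 :: c) i)%N + delta (nth 1 (1 :: c) i.+1)%N)
  * sharp R (nth 0 (0 :: k) i)%N (nth 0 k i)%N (nseq (nth 1 (1 :: c) i - 3)%N 1%N))).
rewrite rmorph_prod -big_split/=; apply: eq_bigr => i _.
rewrite -(tnth_nth 0%N k i) sgn_nat_complex ?tuple_gt0//.
by rewrite rmorphM invfM /=; ring.
Qed.

Definition unit_at (i : nat) : nat := (i == m).

(** Dominates the summands on both sides of the theorem, up to constants. *)
Definition dominator (k : seq nat) : R :=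
  `|sharp_kernel R 0 (1%N :: c) k| * pow_weight R (mkseq unit_at d.+1) k.

Lemma dominator_ge0 k : 0 <= dominator k.
Proof. by rewrite mulr_ge0// pow_weight_ge0. Qed.

Lemma pow_weight_tuple (a k : d.+1.-tuple nat) :
  pow_weight R a k = \prod_(j < d.+1) (tnth k j)%:R ^- (3 + 2 * tnth a j).
Proof.
rewrite /pow_weight (prod_ord_size k (fun i => (nth 0 k i)%N%:R ^- (3 + 2 * nth 0 a i)%N)).
by apply: eq_bigr => j _; rewrite !(tnth_nth 0%N).
Qed.

Lemma pow_weight_unit (k : d.+1.-tuple nat) :
  pow_weight R (mkseq unit_at d.+1) k =
  (tnth k m)%:R ^- 2 * \prod_(j < d.+1) (tnth k j)%:R ^- 3.
Proof.
rewrite /pow_weight (prod_ord_size k (fun i => (nth 0 k i)%N%:R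
  ^- (3 + 2 * nth 0 (mkseq unit_at d.+1) i)%N)).
rewrite (bigD1 m)//= [in RHS](bigD1 m)//= mulrA; congr (_ * _).
  rewrite nth_mkseq// /unit_at eqxx -(tnth_nth 0%N k m) exprD invfM mulrC.
  by rewrite muln1.
apply: eq_bigr => j jm; rewrite nth_mkseq// /unit_at -(tnth_nth 0%N k j).
by move: jm; rewrite -val_eqE/= => /negbTE ->; rewrite muln0 addn0.
Qed.

(** Uses |k^2 - z^2| >= k^2 (1 - |z|^2) for k >= 1. *)
Lemma norm_sharp_term_le (k : d.+1.-tuple nat) : (forall j, `|z j| < 1) ->
  all (leq 1) k ->
  `|sharp_term m c z k| <=
  (\prod_(j < d.+1) (1 - realnorm (z j) ^+ 2)^-1 * dominator k)%:C%C.
Proof.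
move=> z1 k1; rewrite sharp_termE// /dominator pow_weight_unit.
have -> : \prod_(j < d.+1) (1 - realnorm (z j) ^+ 2)^-1 *
      (`|sharp_kernel R 0 (1%N :: c) k| *
       ((tnth k m)%:R ^- 2 * \prod_(j < d.+1) (tnth k j)%:R ^- 3)) =
    `|sharp_kernel R 0 (1%N :: c) k| * ((tnth k m)%:R ^- 2 *
      \prod_(j < d.+1) ((tnth k j)%:R ^- 3 / (1 - realnorm (z j) ^+ 2))).
  by rewrite big_split/=; ring.
rewrite !rmorphM/= normrM normc_real; apply: ler_wpM2l; first by rewrite ler0c.
rewrite normrM fmorphV rmorphXn rmorph_nat/= normfV normrX normr_nat.
apply: ler_wpM2l; first by rewrite invr_ge0 exprn_ge0.
rewrite normr_prod rmorph_prod/=; apply: ler_prod => j _; rewrite normr_ge0/=.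
have kj : 1 <= (tnth k j)%:R :> R[i] by rewrite ler1n tuple_gt0.
have kj0 : 0 < (tnth k j)%:R :> R[i] by apply: lt_le_trans kj.
set n := (tnth k j)%:R : R[i].
have r1 : 0 < 1 - realnorm (z j) ^+ 2.
  by rewrite subr_gt0 expr_lt1// ?realnorm_ge0// realnorm_lt1.
rewrite rmorphM fmorphV rmorphXn rmorph_nat fmorphV rmorphB rmorphXn rmorph1/=.
rewrite -realnormE normfV normrM (ger0_norm (ltW kj0)) -invfM.
have pos : 0 < 1 - `|z j| ^+ 2.
  by rewrite realnormE -rmorphXn -[1]/(1%:C%C) -rmorphB/= -[0]/(0%:C%C) ltcR.
have h : n ^+ 2 * (1 - `|z j| ^+ 2) <= `|n ^+ 2 - z j ^+ 2|.
  apply: (@le_trans _ _ (`|n ^+ 2| - `|z j ^+ 2|)); last exact: lerB_dist.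
  rewrite !normrX (ger0_norm (ltW kj0)) mulrBr mulr1 lerB// ler_peMl ?exprn_ge0//.
  by rewrite exprn_ege1.
rewrite lef_pV2 ?posrE.
- by rewrite exprS -mulrA ler_wpM2l// ltW.
- by rewrite mulr_gt0// (lt_le_trans _ h)// mulr_gt0// exprn_gt0.
- by rewrite mulr_gt0// exprn_gt0.
Qed.

End SharpTerm.

(** * Generating functions *)

Section GeneratingFunctions.
Variables (R : realType) (d : nat) (m : 'I_d.+1) (c : d.-tuple nat).
Variable z : 'I_d.+1 -> R[i].
Hypothesis hc : forall i : 'I_d, (1 <= tnth c i)%N /\ tnth c i <> 2%N.
Hypothesis hc1 : (1 <= m)%N -> (3 <= c_ext c 1)%N.
Hypothesis hz : forall j : 'I_d.+1, `|z j| < 1.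

Let c_ok : all (fun x => (0 < x)%N && (x != 2%N)) c.
Proof. by apply/allP => x /tnthP[i ->]; have [-> /eqP] := hc i. Qed.

Let c_pos : all (leq 1) c.
Proof. by apply: sub_all c_ok => x /andP[]. Qed.

Let weight (N : nat) (k : d.+1.-tuple nat) : R := binratio R N (head 0%N k).

Lemma tzeta_zeta_arg (a : d.+1.-tuple nat) N :
  tzeta R (zeta_arg c a) N = \sum_(k <- chain_tuples d.+1 N)
    weight N k * (sharp_kernel R 0 (1%N :: c) k * pow_weight R a k).
Proof.
rewrite -[zeta_arg c a]/(zargs (thead a) c (behead a)).
rewrite tzeta_zargs ?size_behead ?size_tuple//.
rewrite -(@sharp_kernel_head R (thead a) c (behead a) N (binratio R N)) size_tuple.
have -> : thead a :: behead a = a by case/tupleP: a => x t; rewrite theadE.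
rewrite -(sum_chain_tuples _ (fun k => binratio R N (head 0%N k) *
  (sharp_kernel R 0 (1%N :: c) k * pow_weight R a k))).
by [].
Qed.

Lemma dominator_bound : exists B : R, forall N,
  \sum_(k <- chains d.+1 N) dominator R m c k <= B.
Proof.
have [|/hc1 h|B HB] := @chain_sum_bound R c (mkseq (unit_at m) d.+1) m c_pos.
- by rewrite nth_mkseq// /unit_at eqxx.
- exact: h.
by exists B => N; have := HB N; rewrite size_tuple.
Qed.

(** Since a_m is positive, the power weight of a is at most that of the unit
    multi-index at m; this bounds all truncated values by one constant. *)
Lemma tzeta_le_dominator (a : d.+1.-tuple nat) N : (0 < tnth a m)%N ->
  tzeta R (zeta_arg c a) N <= \sum_(k <- chains d.+1 N) dominator R m c k.
Proof.
move=> am; rewrite tzeta_zeta_arg -sum_chain_tuples.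
rewrite big_seq [leRHS]big_seq; apply: ler_sum => k.
rewrite mem_chain_tuples => /andP[_ k1].
apply: le_trans (ler_norm _) _; rewrite !normrM /dominator.
rewrite (ger0_norm (binratio_ge0 _ _ _)) (ger0_norm (pow_weight_ge0 _ _ _)).
rewrite -[leRHS]mul1r; apply: ler_pM => //.
- exact: binratio_ge0.
- by rewrite mulr_ge0// pow_weight_ge0.
- exact: binratio_le1.
apply: ler_wpM2l => //; apply: pow_weight_anti => // i.
have [id|di] := ltnP i d.+1; last by rewrite nth_default// size_mkseq.
rewrite nth_mkseq// /unit_at; case: eqP => //= ->.
by rewrite -(tnth_nth 0%N a m).
Qed.

Let ratio (k : d.+1.-tuple nat) (j : 'I_d.+1) : R[i] := z j ^+ 2 / (tnth k j)%:R ^+ 2.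

Let ratio_lt1 k j : `|ratio k j| < 1.
Proof.
rewrite /ratio normrM normfV !normrX normr_nat.
(* for an index 0 the ratio is 0, by the convention on division by 0 *)
case: (posnP (tnth k j)) => [->|kj].
  by rewrite expr0n invr0 mulr0 ltr01.
have kj0 : 0 < (tnth k j)%:R :> R[i] by rewrite ltr0n.
rewrite ltr_pdivrMr ?exprn_gt0// mul1r.
apply: (@lt_le_trans _ _ 1); first by rewrite exprn_ilt1.
by rewrite exprn_ege1// ler1n.
Qed.

Definition gf_trunc (N : nat) (a : d.+1.-tuple nat) : R[i] :=
  if (0 < tnth a m)%N then
    (tzeta R (zeta_arg c a) N)%:C%C * \prod_(j < d.+1) z j ^+ (2 * tnth a j)
  else 0.

Definition sharp_sum_trunc (N : nat) : R[i] :=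
  \sum_(k <- chain_tuples d.+1 N) (weight N k)%:C%C * sharp_term m c z k.

Definition gf_sum_trunc (N : nat) : R[i] := z m ^+ 2 * sharp_sum_trunc N.

(** At each finite level the generating function is a finite combination of
    geometric series with ratios z_j^2 / k_j^2, by [tzeta_zeta_arg]. *)
Lemma has_sum_gf_trunc N : has_sum predT (gf_trunc N) (gf_sum_trunc N).
Proof.
pose coef (k : d.+1.-tuple nat) : R[i] :=
  (weight N k * sharp_kernel R 0 (1%N :: c) k)%:C%C
  * \prod_(j < d.+1) (tnth k j)%:R ^- 3.
have -> : gf_trunc N = fun a => \sum_(k <- chain_tuples d.+1 N) coef k *
    (if (0 < tnth a m)%N then \prod_(j < d.+1) ratio k j ^+ tnth a j else 0).
  apply/funext => a; rewrite /gf_trunc; case: ifP => am; last first.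
    by rewrite big1// => k _; rewrite mulr0.
  rewrite tzeta_zeta_arg rmorph_sum mulr_suml; apply: eq_bigr => k _.
  rewrite /coef pow_weight_tuple !rmorphM -!mulrA; congr (_ * (_ * _)).
  rewrite rmorph_prod/= -!big_split/=; apply: eq_bigr => j _.
  rewrite fmorphV rmorphXn rmorph_nat /ratio expr_div_n exprD invfM -!exprM.
  by rewrite -!mulrA; congr (_ * _); rewrite mulrC.
have -> : gf_sum_trunc N = \sum_(k <- chain_tuples d.+1 N) coef k *
    \prod_(j < d.+1) ((if j == m then ratio k j else 1) / (1 - ratio k j)).
  rewrite /gf_sum_trunc /sharp_sum_trunc mulr_sumr; apply: eq_big_seq => k.
  rewrite mem_chain_tuples => /andP[_ k1]; rewrite sharp_termE//.
  set P := \prod_(j < d.+1) _; set Q := \prod_(j < d.+1) _.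
  suff e : \prod_(j < d.+1) (tnth k j)%:R ^- 3 * Q = z m ^+ 2 / (tnth k m)%:R ^+ 2 * P.
    by rewrite /coef rmorphM -[RHS]mulrA e; ring.
  rewrite /Q big_split/= [X in _ * (X * _)](bigD1 m)//= eqxx [X in _ * (_ * X * _)]big1; last first.
    by move=> j /negbTE ->.
  rewrite mulr1 mulrCA; congr (_ * _); rewrite -big_split/=.
  apply: eq_bigr => j _; rewrite /ratio.
  have kj : (tnth k j)%:R != 0 :> R[i] by rewrite pnatr_eq0 -lt0n tuple_gt0.
  have kz : (tnth k j)%:R ^+ 2 - z j ^+ 2 != 0.
    rewrite subr_eq0; apply/eqP => e; have := hz j.
    have : 1 <= `|z j| ^+ 2.
      by rewrite -normrX -e normrX normr_nat exprn_ege1// ler1n tuple_gt0.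
    by rewrite expr_ge1// => /le_lt_trans /[apply]; rewrite ltxx.
  by field; rewrite kj kz.
apply: has_sum_sum => k; apply: has_sumZ; apply: has_sum_geometric.
exact: ratio_lt1.
Qed.

Lemma cvg_sharp_sum_trunc : exists S,
  has_sum (fun k : d.+1.-tuple nat => decr_pos k) (sharp_term m c z) S /\
  (sharp_sum_trunc : nat -> R[i]^o) @ \oo --> (S : R[i]^o).
Proof.
pose f (k : d.+1.-tuple nat) := if decr_pos k then sharp_term m c z k else 0.
pose fN N k := (weight N k)%:C%C * f k.
pose D := \prod_(j < d.+1) (1 - realnorm (z j) ^+ 2)^-1.
have D0 : 0 <= D.
  apply: prodr_ge0 => j _; rewrite invr_ge0 subr_ge0.
  by rewrite exprn_ile1 ?realnorm_ge0// ltW// realnorm_lt1.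
pose g (k : d.+1.-tuple nat) : R :=
  if decr_pos k then D * dominator R m c k else 0.
have fg k : `|f k| <= (g k)%:C%C.
  rewrite /f /g; case: ifP => [/andP[_ k1]|_]; last by rewrite normr0 lexx.
  exact: norm_sharp_term_le.
have fNg N k : `|fN N k| <= (g k)%:C%C.
  apply: le_trans (fg k); rewrite /fN normrM normc_real ler_piMl//.
  rewrite (ger0_norm (binratio_ge0 _ _ _)) -[leRHS]/(1%:C%C) lecR.
  exact: binratio_le1.
have [B HB] := dominator_bound.
have gB : forall J : {fset d.+1.-tuple nat}, \sum_(k <- J) g k <= D * B.
  apply: (@chain_sum_le _ _ (fun k => D * dominator R m c k)) => [k|N].
    by rewrite mulr_ge0// dominator_ge0.
  by rewrite -mulr_sumr ler_wpM2l.
have fNf k : (fN^~ k : nat -> R[i]^o) @ \oo --> (f k : R[i]^o).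
  have h : (fun N => (weight N k)%:C%C * f k : R[i]^o) @ \oo -->
      (1%:C%C * f k : R[i]^o).
    by apply: cvgMr_tmp; apply: cvg_real_complex; exact: cvg_binratio.
  by rewrite mul1r in h.
have fNs N : has_sum predT (fN N) (sharp_sum_trunc N).
  have -> : sharp_sum_trunc N =
      \sum_(k <- [fset k in chain_tuples d.+1 N]%fset) fN N k.
    rewrite sum_fset_seq ?chain_tuples_uniq//; apply: eq_big_seq => k.
    rewrite mem_chain_tuples => /andP[/path_sorted sk k1].
    by rewrite /fN /f /decr_pos sk k1.
  apply: has_sum_finsupp => k; rewrite inE/= mem_chain_tuples /fN /f /decr_pos.
  case: ifP => [/andP[sk k1]|_]; last by rewrite mulr0.
  rewrite k1 andbT => kN; rewrite /weight binratio_small ?mul0r//.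
  move: sk kN; case: (tval k) => //= x s -> ; rewrite andbT -ltnNge.
  exact.
have [S [fS sS]] := dominated_convergence_sum fNg fg gB fNf fNs.
by exists S; split => //; apply/has_sum_mkcond.
Qed.

Lemma cvg_gf_trunc : exists L,
  has_sum (fun a : d.+1.-tuple nat => (1 <= tnth a m)%N) (gf_term c z) L /\
  (gf_sum_trunc : nat -> R[i]^o) @ \oo --> (L : R[i]^o).
Proof.
have [B HB] := dominator_bound.
have B0 : 0 <= B.
  apply: le_trans (HB 0%N); apply: sumr_ge0 => k _; exact: dominator_ge0.
have tB (a : d.+1.-tuple nat) N : (0 < tnth a m)%N -> tzeta R (zeta_arg c a) N <= B.
  by move=> am; apply: le_trans (HB N); exact: tzeta_le_dominator.
pose f (a : d.+1.-tuple nat) := if (0 < tnth a m)%N then gf_term c z a else 0.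
pose b (j : 'I_d.+1) i : R := (realnorm (z j) ^+ 2) ^+ i.
pose g (a : d.+1.-tuple nat) : R := B * \prod_(j < d.+1) b j (tnth a j).
have b0 j i : 0 <= b j i by rewrite !exprn_ge0// realnorm_ge0.
have g0 a : 0 <= g a by rewrite mulr_ge0// prodr_ge0.
have normz (a : d.+1.-tuple nat) : `|\prod_(j < d.+1) z j ^+ (2 * tnth a j)| =
    (\prod_(j < d.+1) b j (tnth a j))%:C%C.
  rewrite normr_prod rmorph_prod; apply: eq_bigr => j _.
  by rewrite normrX realnormE /b -exprM -rmorphXn.
have cvgt (a : d.+1.-tuple nat) : (0 < tnth a m)%N ->
    tzeta R (zeta_arg c a) @ \oo --> zeta_star R (zeta_arg c a).
  by move=> am; apply: (@cvg_zeta_star _ _ B) => N; exact: tB.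
have fNg N a : `|gf_trunc N a| <= (g a)%:C%C.
  rewrite /gf_trunc; case: ifP => am; last by rewrite normr0 -[0]/(0%:C%C) lecR.
  rewrite normrM normz normc_real -rmorphM/= lecR ler_wpM2r ?prodr_ge0//.
  by rewrite ger0_norm ?tzeta_ge0// tB.
have fg a : `|f a| <= (g a)%:C%C.
  rewrite /f; case: ifP => am; last by rewrite normr0 -[0]/(0%:C%C) lecR.
  rewrite /gf_term normrM normz normc_real -rmorphM/= lecR ler_wpM2r ?prodr_ge0//.
  have ct := cvgt a am; rewrite -(cvg_lim (@Rhausdorff R) ct).
  have is_ct := cvgP _ ct; rewrite ger0_norm.
    by apply: limr_le => //; near=> N; exact: tB.
  by apply: limr_ge => //; near=> N; exact: tzeta_ge0.
have gB : forall J : {fset d.+1.-tuple nat}, \sum_(a <- J) g a <=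
    B * \prod_(j < d.+1) (1 - realnorm (z j) ^+ 2)^-1.
  move=> J; rewrite -mulr_sumr ler_wpM2l//.
  apply: prod_summable => // j N; apply: geometric_le.
    by rewrite exprn_ge0// realnorm_ge0.
  by rewrite expr_lt1// ?realnorm_ge0// realnorm_lt1.
have fNf a : (gf_trunc^~ a : nat -> R[i]^o) @ \oo --> (f a : R[i]^o).
  rewrite /gf_trunc /f; case: ifP => am; last exact: cvg_cst.
  by apply: cvgMr_tmp; apply: cvg_real_complex; exact: cvgt.
have [L [fL sL]] := dominated_convergence_sum fNg fg gB fNf has_sum_gf_trunc.
by exists L; split => //; apply/has_sum_mkcond.
Unshelve. all: by end_near. Qed.

End GeneratingFunctions.

Theorem corollary1p5p1 (R : realType) (d : nat) (m : 'I_d.+1)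
    (c : d.-tuple nat) (z : 'I_d.+1 -> R[i])
    (hc : forall i : 'I_d, (1 <= tnth c i)%N /\ tnth c i <> 2%N)
    (hc1 : (1 <= m)%N -> (3 <= c_ext c 1)%N)
    (hz : forall j : 'I_d.+1, `|z j| < 1) :
  exists S : R[i],
    has_sum (fun k : d.+1.-tuple nat => decr_pos k) (sharp_term m c z) S /\
    has_sum (fun a : d.+1.-tuple nat => (1 <= tnth a m)%N) (gf_term c z)
      (z m ^+ 2 * S).
Proof.
have [S [HS cvgS]] := cvg_sharp_sum_trunc hc hc1 hz.
have [L [HL cvgL]] := cvg_gf_trunc hc hc1 hz.
exists S; split; first exact: HS.
suff <- : L = z m ^+ 2 * S by exact: HL.
exact: (lim_scale (fun=> erefl) cvgS cvgL).
Qed.
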